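(* Let $n\ge 1$ be an integer, $\mu\in\mathbb{R}$, and let $0<a<n$, $0<b<1$ with $a\ge nb$. Let $S_{ab}$ be the fractional integral operator on $\mathbb{R}^{2n+1}$ with kernel $\Omega^{ab}$, as defined in the context, and let $1<p<q<\infty$. Then there is a constant $C_{a,b,p}>0$ such that $$\|S_{ab}f\|_{L^q(\mathbb{R}^{2n+1})}\le C_{a,b,p}\,\|f\|_{L^p(\mathbb{R}^{2n+1})}\qquad\text{for all } f\in L^p(\mathbb{R}^{2n+1})$$ if and only if $$\frac{a+b}{n+1}=\frac1p-\frac1q.$$
   Context: Points of $\mathbb{R}^{2n+1}$ are written $(u,v,t)\in\mathbb{R}^n\times\mathbb{R}^n\times\mathbb{R}$. For fixed $\mu\in\mathbb{R}$, the Heisenberg-type multiplication law is $$(u,v,t)\odot(\xi,\eta,\tau)=\big(u+\xi,\;v+\eta,\;t+\tau+\mu(u\cdot\eta-v\cdot\xi)\big),\qquad (\xi,\eta,\tau)^{-1}=(-\xi,-\eta,-\tau),$$ so that $(u,v,t)\odot(\xi,\eta,\tau)^{-1}=\big(u-\xi,\;v-\eta,\;t-\tau-\mu(u\cdot\eta-v\cdot\xi)\big)$. The kernel is $$\Omega^{ab}(\xi,\eta,\tau)=\left[\frac{1}{|\xi|^2+|\eta|^2}\right]^{n-a}\left[\frac{1}{|\xi|^2+|\eta|^2+|\tau|}\right]^{1-b},\qquad (\xi,\eta)\ne(0,0),$$ regarded as an almost everywhere defined nonnegative function on $\mathbb{R}^{2n+1}$, and $$S_{ab}f(u,v,t)=\iiint_{\mathbb{R}^{2n+1}}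 f(\xi,\eta,\tau)\,\Omega^{ab}\big[(u,v,t)\odot(\xi,\eta,\tau)^{-1}\big]\,d\xi\,d\eta\,d\tau .$$ For $f\ge0$ the integral takes values in $[0,\infty]$; the norm inequality for all $f\in L^p$ includes that the integral converges absolutely for almost every $(u,v,t)$. The constant $C_{a,b,p}$ depends only on its sub-indices ($n$ and $\mu$ being fixed; $q$ is determined by $a,b,p,n$ under the homogeneity condition). *)

(* Defs.v *)
From HB Require Import structures.
From mathcomp Require Import all_boot all_order all_algebra.
From mathcomp Require Import all_classical all_reals all_analysis.

Set Implicit Arguments.
Unset Strict Implicit.
Unset Printing Implicit Defensive.
Import Order.TTheory GRing.Theory Num.Theory.
Import numFieldNormedType.Exports.

Local Open Scope classical_set_scope.
Local Open Scope ring_scope.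

(* [m1 \x m2] under a new head constant: the sigma-finite instance inferred for
   a bare [_ \x _] in mathcomp-analysis 1.16 is the one for subprobability
   measures, which does not apply to Lebesgue measure. *)
Section prod_measure.
Context d1 d2 (T1 : measurableType d1) (T2 : measurableType d2) (R : realType).
Variable m1 : {sigma_finite_measure set T1 -> \bar R}.
Variable m2 : {sigma_finite_measure set T2 -> \bar R}.

Definition prod_measure : set (T1 * T2)%type -> \bar R := (m1 \x m2)%E.

HB.instance Definition _ := Measure.on prod_measure.

Let prod_measure_sigma_finite : sigma_finite setT prod_measure.
Proof.
have /sigma_finiteP[F [TF ndF Foo]] := sigma_finiteT m1.
have /sigma_finiteP[G [TG ndG Goo]] := sigma_finiteT m2.
exists (fun k => F k `*` G k).
  rewrite -setXTT TF TG predeqE => -[x y]; split.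
    move=> [/= [k _ Fkx] [l _ Gly]]; exists (maxn k l) => //; split.
    - by move: x Fkx; exact/subsetPset/ndF/leq_maxl.
    - by move: y Gly; exact/subsetPset/ndG/leq_maxr.
  by move=> [k _ []/= ? ?]; split; exists k.
move=> k; have [? ?] := Foo k; have [? ?] := Goo k.
split; first exact: measurableX.
by rewrite /prod_measure product_measure1E// lte_mul_pinfty// ge0_fin_numE.
Qed.

HB.instance Definition _ := Measure_isSigmaFinite.Build _ _ _ prod_measure
  prod_measure_sigma_finite.

End prod_measure.

(* R^n is [n.-tuple R] with the product (Borel) sigma-algebra.  Its Lebesgue
   measure is obtained by iterating the product with the one-dimensional
   Lebesgue measure, transported along (x, t) |-> x :: t. *)
Section lebesgue_tuple.
Context (R : realType).
Local Notation RM := (measurableTypeR R).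

Section cons_measure.
Variables (n : nat) (m : {sigma_finite_measure set (n.-tuple RM) -> \bar R}).

Definition tuple_cons (p : RM * n.-tuple RM) : n.+1.-tuple RM :=
  [tuple of p.1 :: p.2].

Lemma measurable_tuple_cons : measurable_fun [set: RM * n.-tuple RM] tuple_cons.
Proof. exact: (measurable_cons measurable_fst measurable_snd). Qed.

Definition cons_measure : set (n.+1.-tuple RM) -> \bar R :=
  pushforward (prod_measure (@lebesgue_measure R) m) tuple_cons.

Let cons_measure0 : cons_measure set0 = 0%E.
Proof. by rewrite /cons_measure /pushforward preimage_set0 measure0. Qed.

Let cons_measure_ge0 A : (0 <= cons_measure A)%E.
Proof. exact: (measure_ge0 (prod_measure (@lebesgue_measure R) m)). Qed.

Let cons_measure_semi_sigma_additive : semi_sigma_additive cons_measure.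
Proof.
have mc := measurable_tuple_cons.
move=> F mF tF mUF; rewrite /cons_measure /pushforward preimage_bigcup.
apply: measure_semi_sigma_additive.
- by move=> k; rewrite -[X in measurable X]setTI; exact: mc.
- apply/trivIsetP => /= i j _ _ ij; rewrite -preimage_setI.
  by move/trivIsetP : tF => /(_ _ _ _ _ ij) ->//; rewrite preimage_set0.
- by rewrite -preimage_bigcup -[X in measurable X]setTI; exact: mc.
Qed.

HB.instance Definition _ := isMeasure.Build _ _ _ cons_measure
  cons_measure0 cons_measure_ge0 cons_measure_semi_sigma_additive.

Let cons_measure_sigma_finite : sigma_finite setT cons_measure.
Proof.
have [F FT Foo] := sigma_finiteT (prod_measure (@lebesgue_measure R) m).
pose g (t : n.+1.-tuple RM) : RM * n.-tuple RM :=
  (thead t, [tuple of behead t]).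
have mg : measurable_fun [set: n.+1.-tuple RM] g.
  apply: measurable_fun_pair; first exact: measurable_tnth.
  exact: measurable_behead.
have gK : cancel tuple_cons g.
  by move=> [x t]; congr pair; apply/val_inj.
exists (fun k => g @^-1` F k) => [|k].
  by rewrite -preimage_bigcup -FT preimage_setT.
have [mF Fk] := Foo k; split.
  by rewrite -[X in measurable X]setTI; exact: mg.
rewrite /cons_measure /pushforward -comp_preimage.
by rewrite (_ : g \o tuple_cons = id) //; apply/funext.
Qed.

HB.instance Definition _ := Measure_isSigmaFinite.Build _ _ _ cons_measure
  cons_measure_sigma_finite.

End cons_measure.

Fixpoint lebesgue_tuple (n : nat) :
    {sigma_finite_measure set (n.-tuple RM) -> \bar R} :=
  match n with
  | 0 => \d_([tuple] : 0.-tuple RM)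
  | n'.+1 => cons_measure (lebesgue_tuple n')
  end.

End lebesgue_tuple.

(* Points (u, v, t) of R^n * R^n * R. *)
Notation heis R n := ((n.-tuple (measurableTypeR R) *
  n.-tuple (measurableTypeR R)) * measurableTypeR R)%type.

Section heisenberg.
Context (R : realType) (n : nat).
Local Notation Rn := (n.-tuple (measurableTypeR R)).

Definition lebesgue_heis : {sigma_finite_measure set (heis R n) -> \bar R} :=
  prod_measure (prod_measure (lebesgue_tuple R n) (lebesgue_tuple R n))
    (@lebesgue_measure R).

Definition tadd (x y : Rn) : Rn := [tuple tnth x i + tnth y i : R | i < n].

Definition topp (x : Rn) : Rn := [tuple - tnth x i : R | i < n].

Definition tdot (x y : Rn) : R := \sum_(i < n) tnth x i * tnth y i.

Definition heis_mul (mu : R) (x y : heis R n) : heis R n :=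
  let: (u, v, t) := x in let: (xi, eta, tau) := y in
  (tadd u xi, tadd v eta, (t + tau + mu * (tdot u eta - tdot v xi)) : R).

Definition heis_inv (x : heis R n) : heis R n :=
  let: (xi, eta, tau) := x in (topp xi, topp eta, (- tau) : R).

(* On the null set xi = eta = 0, where the kernel is left undefined, this is 0
   when a <> n, by the convention 0^-1 = 0. *)
Definition Omega (a b : R) (x : heis R n) : R :=
  let: (xi, eta, tau) := x in
  (tdot xi xi + tdot eta eta)^-1 `^ (n%:R - a) *
  (tdot xi xi + tdot eta eta + `|tau : R|)^-1 `^ (1 - b).

Definition Sab_integrand (mu a b : R) (f : heis R n -> R) (x y : heis R n) : \bar R :=
  (f y * Omega a b (heis_mul mu x (heis_inv y)))%:E.

Definition Sab (mu a b : R) (f : heis R n -> R) (x : heis R n) : \bar R :=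
  (\int[lebesgue_heis]_y Sab_integrand mu a b f x y)%E.

End heisenberg.

(* Main.v *)
(* Since |xi|^2 + |eta|^2 dominates each xi_i^2 + eta_i^2 >= |xi_i| |eta_i| and a >= n b,
   the homogeneity condition gives, with g = (a + b) / (n + 1) = 1/p - 1/q,
     Omega(xi, eta, tau) <= prod_i |xi_i|^(g-1) |eta_i|^(g-1) * |tau|^(g-1).
   So the one-dimensional Hardy-Littlewood-Sobolev inequality, applied in one variable at
   a time in its bilinear form (which tensorizes by Tonelli), yields
     int int H(x)^(1-1/q) F(y)^(1/p) Omega(x y^-1) <= C (int H)^(1-1/q) (int F)^(1/p);
   the twist of the group law is only a translation of the last variable, to which the
   one-dimensional bound is insensitive.  The L^p -> L^q bound follows by duality.
   Conversely, testing on the indicator of [0,s]^(2n) x [0,s^2] and integrating over the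
   disjoint box [2s,3s]^(2n) x [0,s^2] bounds a fixed power of s on both sides for all
   s > 0, which forces the exponents to agree. *)
Require Import Defs.
From HB Require Import structures.
From mathcomp Require Import all_boot all_order all_algebra.
From mathcomp Require Import all_classical all_reals all_analysis.
From mathcomp Require Import measurable_realfun.
From mathcomp Require Import ring lra.

Set Implicit Arguments.
Unset Strict Implicit.
Unset Printing Implicit Defensive.
Import Order.TTheory GRing.Theory Num.Theory.
Import numFieldNormedType.Exports.

Local Open Scope classical_set_scope.
Local Open Scope ring_scope.

(** * A pointwise substitute for interpolation *)

(** The one-dimensional inequality is proved by a pointwise bound, without maximal functions or
    interpolation. Put al = 1/p, be = 1 - 1/q and lam = 2 - al - be = 1 - g. At each pair of points,
    F^al H^be d^-lam is at most FH, or F^2 k(Fd), or H^2 k(Hd), where k(s) is comparable to s^-lam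
    for s <= 1 and to s^-kap for s > 1. The sets d <= r have measure at most 2r in either variable,
    so F^2 k(Fd) integrated over the variable of H is O(F), and symmetrically for H. Convergence at
    s = 0 is lam < 1, that is p < q. At infinity it is lam/(1 - be) > 1 and lam/(1 - al) > 1, that
    is p > 1 and q < oo. Only the measures of the sublevel sets of d enter, and this is what makes
    the constant blind to translations. Dominating kernels take the value +oo where a coordinate
    vanishes: the domination then holds at every point, and the price is a null set in each
    one-dimensional integral. *)

Section log_trichotomy.
Context (R : realType) (al be : R).
Hypotheses (al1 : al < 1) (be0 : 0 < be) (be1 : be < 1).
Let lam : R := 2 - al - be.

(* Logarithmic form: e^f and e^h are the two densities, e^d is the distance.
   The exponent lam / (1 - be) comes from eliminating h with the second hypothesis. *)
Lemma log_trichotomy_half (f h d : R) : h <= f ->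
  f + h < al * f + be * h - lam * d ->
  (f + d <= 0 /\ al * f + be * h - lam * d <= 2 * f - lam * (f + d)) \/
  (0 < f + d /\
   al * f + be * h - lam * d <= 2 * f - lam / (1 - be) * (f + d)).
Proof.
move=> hf E; have [fd|fd] := leP (f + d) 0; [left|right]; split => //.
  have := ler_wpM2l (ltW be0) hf.
  rewrite /lam => /= ?. by lra.
have b1 : 0 < 1 - be by rewrite subr_gt0.
rewrite -(ler_pM2l b1).
rewrite [X in _ <= X](_ : _ = (1 - be) * (2 * f) - lam * (f + d)); last first.
  by field; rewrite gt_eqF.
move: E; rewrite /lam => E.
have : 0 < be * ((al * f + be * h - (2 - al - be) * d) - (f + h)) by rewrite pmulr_rgt0// subr_gt0.
lra.
Qed.

End log_trichotomy.

Section pointwise.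
Context (R : realType).

(* Pairs (coefficient, threshold): s^-lam is at most the coefficient of wsmall for some j
   whose threshold is >= s when s <= 1, and likewise s^-kap with wlarge when s > 1. *)
Definition wsmall (lam : R) (j : nat) : R * R :=
  (expR (lam * j.+1%:R), expR (- j%:R)).
Definition wlarge (kap : R) (j : nat) : R * R :=
  (expR (- kap * j%:R), expR j.+1%:R).

Lemma wsmall_dominates (lam s : R) : 0 < lam -> s <= 0 ->
  exists j, expR (- lam * s) <= (wsmall lam j).1 /\ expR s <= (wsmall lam j).2.
Proof.
move=> l0 s0; have := @truncn_itv R (- s); rewrite oppr_ge0 => /(_ s0)/andP[t1 t2].
(* With [j <= - s < j + 1], the lower bound serves the threshold and the upper one the coefficient,
   which therefore carries [j.+1]. In [wlarge_dominates] the two roles are exchanged. *)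
exists (Num.truncn (- s)); rewrite /= !ler_expR; split; nra.
Qed.

Lemma wlarge_dominates (kap s : R) : 0 < kap -> 0 < s ->
  exists j, expR (- kap * s) <= (wlarge kap j).1 /\ expR s <= (wlarge kap j).2.
Proof.
move=> l0 s0; have := @truncn_itv R s; rewrite (ltW s0) => /(_ isT)/andP[t1 t2].
exists (Num.truncn s); rewrite /= !ler_expR; split; nra.
Qed.

(** In the half [H <= F] everything is controlled through [F * d]; the other half is its mirror
    image with [al] and [be] exchanged. Logarithms turn the inequalities between powers into linear
    ones. *)
Lemma weak_trilinear_half (al be F H d : R) :
  al < 1 -> 0 < be -> be < 1 -> 0 < F -> 0 < H -> 0 < d ->
  H <= F -> F * H < F `^ al * H `^ be * d `^ (- (2 - al - be)) ->
  exists j,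
  (F `^ al * H `^ be * d `^ (- (2 - al - be)) <=
     (wsmall (2 - al - be) j).1 * (F * F) /\
     F * d <= (wsmall (2 - al - be) j).2) \/
  (F `^ al * H `^ be * d `^ (- (2 - al - be)) <=
     (wlarge ((2 - al - be) / (1 - be)) j).1 * (F * F) /\
     F * d <= (wlarge ((2 - al - be) / (1 - be)) j).2).
Proof.
move=> al1 be0 be1 F0 H0 d0; rewrite -[F]lnK// -[H]lnK// -[d]lnK//.
move: (ln F) (ln H) (ln d) => f h e {F H d F0 H0 d0}.
have lam0 : 0 < 2 - al - be by lra.
have kap0 : 0 < (2 - al - be) / (1 - be) by rewrite divr_gt0// subr_gt0.
rewrite -!expRM -!expRD ler_expR ltr_expR => hf X.
have XE : f * al + h * be + e * - (2 - al - be) =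
    al * f + be * h - (2 - al - be) * e by ring.
rewrite XE in X *.
have [[fe E]|[fe E]] := log_trichotomy_half be0 be1 hf X.
- have [j [j1 j2]] := wsmall_dominates lam0 fe.
  exists j; left; split => //.
  apply: (@le_trans _ _ (expR (- (2 - al - be) * (f + e)) * expR (f + f)));
    last by rewrite ler_wpM2r// expR_ge0.
  by rewrite -!expRD ler_expR; lra.
- have [j [j1 j2]] := wlarge_dominates kap0 fe.
  exists j; right; split => //.
  apply: (@le_trans _ _ (expR (- ((2 - al - be) / (1 - be)) * (f + e)) *
    expR (f + f)));
    last by rewrite ler_wpM2r// expR_ge0.
  by rewrite -!expRD ler_expR; lra.
Qed.

(* Replaces real interpolation: F^al H^be d^-lam is dominated pointwise by FH plus functions
   of (F, d) alone and of (H, d) alone whose integral in the missing variable is O(F), O(H). *)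
Lemma weak_trilinear (al be F H d : R) :
  0 < al -> al < 1 -> 0 < be -> be < 1 -> 0 < F -> 0 < H -> 0 < d ->
  let X := F `^ al * H `^ be * d `^ (- (2 - al - be)) in
  let w1 := wsmall (2 - al - be) in
  let w2 c := wlarge ((2 - al - be) / (1 - c)) in
  [\/ X <= F * H,
   (exists j, (X <= (w1 j).1 * (F * F) /\ F * d <= (w1 j).2) \/
              (X <= (w2 be j).1 * (F * F) /\ F * d <= (w2 be j).2)) |
   (exists j, (X <= (w1 j).1 * (H * H) /\ H * d <= (w1 j).2) \/
              (X <= (w2 al j).1 * (H * H) /\ H * d <= (w2 al j).2))].
Proof.
move=> al0 al1 be0 be1 F0 H0 d0 X w1 w2.
have [XFH|XFH] := leP X (F * H); first by constructor 1.
have [HF|/ltW FH] := leP H F.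
  by constructor 2; exact: weak_trilinear_half.
constructor 3; rewrite /w1 /w2 /X.
have E : F `^ al * H `^ be * d `^ (- (2 - al - be)) =
    H `^ be * F `^ al * d `^ (- (2 - be - al)).
  by rewrite [in RHS](mulrC (H `^ be)); congr (_ * _ `^ (- _)); ring.
have lamE : 2 - al - be = 2 - be - al by ring.
rewrite E lamE.
apply: weak_trilinear_half => //.
by rewrite -E (mulrC H).
Qed.

End pointwise.

(** * Level-set series and their integrals *)

Section riesz.
Local Open Scope ereal_scope.
Context (R : realType).

(* The value [+oo] at 0 makes products of such kernels dominate Omega everywhere. *)
Definition riesz (lam d : R) : \bar R :=
  if d == 0%R then +oo else (d `^ (- lam))%:E.

Lemma riesz_ge0 lam d : 0 <= riesz lam d.
Proof. by rewrite /riesz; case: ifPn => // _; rewrite lee_fin powR_ge0. Qed.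

Lemma measurable_riesz lam : measurable_fun [set: R] (riesz lam).
Proof.
apply: measurable_fun_ifT => //=.
- exact: measurable_fun_eqr.
- apply/measurable_EFinP; exact: measurable_powR.
Qed.

(** Stands for [F^2] on the set [d <= rho / F]; writing the threshold as a product keeps it
    meaningful for [F = 0] and [F = +oo]. *)
Definition level_term (F : \bar R) (rho d : R) : \bar R :=
  F * F * (\1_[set t : R | (F * t%:E <= rho%:E)%E] d)%:E.

Definition level_series (w : nat -> R * R) (F : \bar R) (d : R) : \bar R :=
  \sum_(j <oo) ((w j).1)%:E * level_term F (w j).2 d.

Lemma level_term_ge0 F rho d : 0 <= level_term F rho d.
Proof.
rewrite mule_ge0 ?lee_fin//; case: F => [r| |]; rewrite ?mulyy ?mulNyNy//.
by rewrite -EFinM lee_fin -expr2 sqr_ge0.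
Qed.

Lemma level_series_ge0 w F d : (forall j, 0 <= (w j).1)%R ->
  0 <= level_series w F d.
Proof.
by move=> w0; apply: nneseries_ge0 => j _ _; rewrite mule_ge0 ?lee_fin ?level_term_ge0.
Qed.

Lemma level_series_ge w F d j : (forall j, 0 <= (w j).1)%R ->
  F * d%:E <= ((w j).2)%:E -> ((w j).1)%:E * (F * F) <= level_series w F d.
Proof.
move=> w0 Fd; have u0 n : 0 <= ((w n).1)%:E * level_term F (w n).2 d.
  by rewrite mule_ge0 ?lee_fin ?level_term_ge0.
apply: le_trans (nneseries_lim_ge (m := 0) (P := xpredT) j.+1 (fun n _ _ => u0 n)).
rewrite big_nat_recr//=.
apply: le_trans (leeDr _ _); last by apply: sume_ge0 => i _; exact: u0.
by rewrite /level_term indicE mem_set// mule1.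
Qed.

Section measurable_level.
Context d (T : measurableType d).
Variables (F : T -> \bar R) (D : T -> R).
Hypotheses (mF : measurable_fun setT F) (mD : measurable_fun setT D).

Lemma measurable_level_term rho :
  measurable_fun setT (fun z => level_term (F z) rho (D z)).
Proof.
apply: emeasurable_funM; first exact: emeasurable_funM.
apply/measurable_EFinP.
rewrite (_ : (fun x => _) =
    \1_(setT `&` [set z | (F z * (D z)%:E <= rho%:E)%E])); last first.
  by apply/funext => z; rewrite setTI !indicE.
apply: measurable_indic; apply: measurable_lee => //.
by apply: emeasurable_funM => //; exact/measurable_EFinP.
Qed.

Lemma measurable_level_series w : (forall j, 0 <= (w j).1)%R ->
  measurable_fun setT (fun z => level_series w (F z) (D z)).
Proof.
move=> w0; apply: ge0_emeasurable_sum => [j z _ _|j _].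
  by rewrite mule_ge0 ?lee_fin ?level_term_ge0.
by apply: emeasurable_funM => //; exact: measurable_level_term.
Qed.
End measurable_level.

Section integral_level.
Context d (T : measurableType d) (m : {measure set T -> \bar R}).
Variable D : T -> R.
Hypotheses (mD : measurable_fun setT D).
Hypothesis Dlevel : forall r : R, (0 <= r)%R -> m [set x | (D x <= r)%R] <= (2 * r)%:E.

(** For finite [F > 0] the level set lies in [D <= rho / F], of measure at most [2 rho / F]. This
    cancels one of the two factors [F], so the bound is linear in [F]. *)
Lemma integral_level_term F (rho : R) : 0 <= F -> (0 < rho)%R ->
  \int[m]_x level_term F rho (D x) <= (2 * rho)%:E * F.
Proof.
move=> F0 rho0.
have mA : measurable [set x | F * (D x)%:E <= rho%:E].
  rewrite -[X in measurable X]setTI; apply: measurable_lee => //.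
  by apply: emeasurable_funM => //; exact/measurable_EFinP.
under eq_integral => x _.
  rewrite /level_term (_ : \1__ (D x) = \1_[set x | (F * (D x)%:E <= rho%:E)%E] x)//.
  over.
rewrite ge0_integralZl//=; last 2 first.
- by apply/measurable_EFinP; exact: measurable_indic.
- by rewrite mule_ge0.
rewrite integral_indic// setIT.
case: F F0 mA => [r| |//]; last first.
  by move=> _ _; rewrite [X in _ <= X]gt0_muley ?leey// lte_fin mulr_gt0.
rewrite lee_fin le_eqVlt => /orP[/eqP<-|r0] mA; first by rewrite !mul0e mule0.
have /(lee_wpmul2l (x := (r * r)%:E)) : m [set x | r%:E * (D x)%:E <= rho%:E] <= (2 * (rho / r))%:E.
  apply: le_trans (Dlevel _); last by rewrite divr_ge0// ltW.
  apply: le_measure; rewrite ?inE//.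
    under eq_set do rewrite -lee_fin.
    rewrite -[X in measurable X]setTI; apply: measurable_lee => //.
    exact/measurable_EFinP.
  by move=> x /=; rewrite lee_fin ler_pdivlMr// mulrC.
rewrite lee_fin mulr_ge0 ?(ltW r0)// => /(_ isT).
move=> /le_trans; apply; rewrite -!EFinM lee_fin.
by rewrite (_ : (r * r * _ = 2 * rho * r)%R)//; field; rewrite gt_eqF.
Qed.

Lemma integral_level_series (w : nat -> R * R) F : 0 <= F ->
  (forall j, 0 < (w j).1)%R -> (forall j, 0 < (w j).2)%R ->
  \int[m]_x level_series w F (D x) <=
    (\sum_(j <oo) ((w j).1 * (2 * (w j).2))%:E) * F.
Proof.
move=> F0 w10 w20; rewrite integral_nneseries//; last 2 first.
- by move=> j; apply: emeasurable_funM => //; exact: measurable_level_term.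
- by move=> j x _; rewrite mule_ge0 ?lee_fin ?level_term_ge0 ?ltW.
have w10' j : (0 <= (w j).1)%R := ltW (w10 j).
have termle j : \int[m]_x (((w j).1)%:E * level_term F (w j).2 (D x)) <=
    ((w j).1 * (2 * (w j).2))%:E * F.
  rewrite ge0_integralZl_EFin//; last 2 first.
  - by move=> x _; exact: level_term_ge0.
  - exact: measurable_level_term.
  by rewrite EFinM -muleA lee_wpmul2l ?lee_fin// integral_level_term.
apply: le_trans (lee_nneseries _ (fun j _ => termle j)) _.
  by move=> j _ _; apply: integral_ge0 => x _; rewrite mule_ge0 ?lee_fin ?level_term_ge0.
have c0 j : (0 <= (w j).1 * (2 * (w j).2))%R.
  by rewrite mulr_ge0// mulr_ge0// ltW.
case: F F0 {termle} => [r r0|_|//].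
  rewrite muleC -nneseriesZl; last by move=> j _; rewrite lee_fin.
  by under eq_eseriesr do rewrite muleC.
(* For [F = +oo] the right side has to be [+oo] and not [0 * +oo = 0]: the first term alone already
   makes the sum positive. *)
rewrite muleC gt0_mulye ?leey//.
have c0' j : 0 <= ((w j).1 * (2 * (w j).2))%:E by rewrite lee_fin.
apply: lt_le_trans (nneseries_lim_ge (m := 0) (P := xpredT) 1 (fun n _ _ => c0' n)).
by rewrite big_nat1 lte_fin !mulr_gt0.
Qed.
End integral_level.


(** The terms form a geometric sequence of ratio [expR (lam - 1)]; in [wlarge_summable] the ratio is
    [expR (1 - kap)]. *)
Lemma wsmall_summable (lam : R) : (lam < 1)%R ->
  \sum_(j <oo) ((wsmall lam j).1 * (2 * (wsmall lam j).2))%:E < +oo.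
Proof.
move=> lam1; set z := expR (lam - 1); set a := (2 * expR lam)%R.
rewrite (_ : (fun n => _) = EFin \o series (geometric a z)); last first.
  apply/funext => n /=; rewrite sumEFin; congr EFin; apply: eq_bigr => j _.
  rewrite /geometric /= -expRM_natr /a mulrCA -expRD -mulrA -expRD.
  by congr (_ * expR _)%R; rewrite -natr1; ring.
rewrite EFin_lim ?ltry//; apply: is_cvg_geometric_series.
by rewrite ger0_norm ?expR_ge0// -expR0 ltr_expR subr_lt0.
Qed.

Lemma wlarge_summable (kap : R) : (1 < kap)%R ->
  \sum_(j <oo) ((wlarge kap j).1 * (2 * (wlarge kap j).2))%:E < +oo.
Proof.
move=> kap1; set z := expR (1 - kap); pose a : R := (2 * expR 1)%R.
rewrite (_ : (fun n => _) = EFin \o series (geometric a z)); last first.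
  apply/funext => n /=; rewrite sumEFin; congr EFin; apply: eq_bigr => j _.
  rewrite /geometric /= -expRM_natr /a mulrCA -expRD -mulrA -expRD.
  by congr (_ * expR _)%R; rewrite -natr1; ring.
rewrite EFin_lim ?ltry//; apply: is_cvg_geometric_series.
by rewrite ger0_norm ?expR_ge0// -expR0 ltr_expR subr_lt0.
Qed.

Lemma lee_wpDr_ereal (x y z : \bar R) : 0 <= y -> x <= z -> x <= z + y.
Proof. by move=> y0 /le_trans; apply; rewrite leeDl. Qed.

Lemma lee_wpDl_ereal (x y z : \bar R) : 0 <= y -> x <= z -> x <= y + z.
Proof. by move=> y0 /le_trans; apply; rewrite leeDr. Qed.

(** Extended-valued form of [weak_trilinear]. If [F] or [H] is 0 the left side vanishes, and if
    [H * F = +oo] the right side is [+oo]; only finite positive values remain. *)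
Lemma riesz_trilinear_le (al be : R) (F H : \bar R) (d : R) :
  (0 < al)%R -> (al < 1)%R -> (0 < be)%R -> (be < 1)%R -> 0 <= F -> 0 <= H ->
  (0 < d)%R ->
  H `^ be * F `^ al * riesz (2 - al - be) d <=
  H * F + (level_series (wsmall (2 - al - be)) F d +
           level_series (wlarge ((2 - al - be) / (1 - be))) F d)
        + (level_series (wsmall (2 - al - be)) H d +
           level_series (wlarge ((2 - al - be) / (1 - al))) H d).
Proof.
move=> al0 al1 be0 be1 F0 H0 d0.
set w1 := wsmall (2 - al - be).
pose w2 c := wlarge ((2 - al - be) / (1 - c)).
rewrite -/(w2 be) -/(w2 al).
have w10 j : (0 <= (w1 j).1)%R by exact: expR_ge0.
have w20 c j : (0 <= (w2 c j).1)%R by exact: expR_ge0.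
have LF0 := level_series_ge0 F d w10.
have LH0 := level_series_ge0 H d w10.
have LF0' := level_series_ge0 F d (w20 be).
have LH0' := level_series_ge0 H d (w20 al).
have HF0 : 0 <= H * F by exact: mule_ge0.
have [->|Fn0] := eqVneq F 0.
  by rewrite poweR0r ?gt_eqF// !mule0 mul0e !adde_ge0 ?level_series_ge0.
have [->|Hn0] := eqVneq H 0.
  by rewrite poweR0r ?gt_eqF// !mul0e !adde_ge0 ?level_series_ge0.
have Fp : 0 < F by rewrite lt0e Fn0.
have Hp : 0 < H by rewrite lt0e Hn0.
have [FH|] := eqVneq (H * F) +oo.
  apply: lee_wpDr_ereal (adde_ge0 LH0 LH0') _.
  by apply: lee_wpDr_ereal (adde_ge0 LF0 LF0') _; rewrite FH; exact: leey.
move: Fp Hp F0 H0 HF0 LF0 LH0 LF0' LH0' {Fn0 Hn0}.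
case: F => [f||//]; last first.
  by move=> _ Hp _ _ _ _ _ _ _; rewrite gt0_muley// eqxx.
case: H => [h||]; last by move=> _.
  2: by move=> Fp _ _ _ _ _ _ _ _; rewrite gt0_mulye// eqxx.
rewrite !lte_fin => f0 h0 _ _ HF0 LF0 LH0 LF0' LH0' _.
rewrite /riesz gt_eqF// !poweR_EFin -!EFinM.
have := weak_trilinear al0 al1 be0 be1 f0 h0 d0.
rewrite /= -/w1 -/(w2 be) -/(w2 al) (mulrC (f `^ al)%R) => -[E|[j E]|[j E]].
- apply: lee_wpDr_ereal (adde_ge0 LH0 LH0') _.
  apply: lee_wpDr_ereal (adde_ge0 LF0 LF0') _.
  by rewrite lee_fin (mulrC h).
- apply: lee_wpDr_ereal (adde_ge0 LH0 LH0') _; apply: lee_wpDl_ereal HF0 _.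
  case: E => -[E1 E2].
  + apply: lee_wpDr_ereal LF0' _.
    by apply: le_trans (level_series_ge (j := j) w10 _); rewrite -?EFinM lee_fin.
  + apply: lee_wpDl_ereal LF0 _.
    by apply: le_trans (level_series_ge (j := j) (w20 be) _); rewrite -?EFinM lee_fin.
- apply: lee_wpDl_ereal (adde_ge0 HF0 (adde_ge0 LF0 LF0')) _.
  case: E => -[E1 E2].
  + apply: lee_wpDr_ereal LH0' _.
    by apply: le_trans (level_series_ge (j := j) w10 _); rewrite -?EFinM lee_fin.
  + apply: lee_wpDl_ereal LH0 _.
    by apply: le_trans (level_series_ge (j := j) (w20 al) _); rewrite -?EFinM lee_fin.
Qed.

End riesz.

(** * One-dimensional Hardy-Littlewood-Sobolev inequality *)

Section prod_integral.
Local Open Scope ereal_scope.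
Context d1 d2 (X : measurableType d1) (Y : measurableType d2) (R : realType).
Variable m1 : {sigma_finite_measure set X -> \bar R}.
Variable m2 : {sigma_finite_measure set Y -> \bar R}.
Variable f : X * Y -> \bar R.
Hypotheses (mf : measurable_fun setT f) (f0 : forall z, 0 <= f z).

Lemma integral_prod_measure :
  \int[prod_measure m1 m2]_z f z = \int[m1]_x \int[m2]_y f (x, y).
Proof. exact: fubini_tonelli1. Qed.

Lemma integral_prod_measure_swap :
  \int[prod_measure m1 m2]_z f z = \int[m2]_y \int[m1]_x f (x, y).
Proof. exact: fubini_tonelli2. Qed.

Lemma measurable_integral_section : measurable_fun setT (fun x => \int[m2]_y f (x, y)).
Proof. exact: measurable_fun_fubini_tonelli_F. Qed.

Lemma measurable_integral_section2 : measurable_fun setT (fun y => \int[m1]_x f (x, y)).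
Proof. exact: measurable_fun_fubini_tonelli_G. Qed.

End prod_integral.

Lemma measurable_section1 d1 d2 d3 (X : measurableType d1) (Y : measurableType d2)
    (Z : measurableType d3) (f : X * Y -> Z) x :
  measurable_fun setT f -> measurable_fun setT (fun y => f (x, y)).
Proof. by move=> mf; apply: measurableT_comp mf _; exact: pair1_measurable. Qed.

Lemma measurable_section2 d1 d2 d3 (X : measurableType d1) (Y : measurableType d2)
    (Z : measurableType d3) (f : X * Y -> Z) y :
  measurable_fun setT f -> measurable_fun setT (fun x => f (x, y)).
Proof. by move=> mf; apply: measurableT_comp mf _; exact: pair2_measurable. Qed.

Section bilinear.
Local Open Scope ereal_scope.
Context (R : realType) (al be : R).

(* H and F stand for |h|^(1/be) and |f|^(1/al): the exponents are put on the integrands so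
   that partial integrals of H and F are again admissible, which makes the bound tensorize. *)
Definition bilinear_bound d1 d2 (X : measurableType d1) (Y : measurableType d2)
    (m1 : {measure set X -> \bar R}) (m2 : {measure set Y -> \bar R})
    (K : X * Y -> \bar R) (C : R) : Prop :=
  forall (H : X -> \bar R) (F : Y -> \bar R),
    measurable_fun setT H -> measurable_fun setT F ->
    (forall x, 0 <= H x) -> (forall y, 0 <= F y) ->
    \int[m1]_x \int[m2]_y (H x `^ be * F y `^ al * K (x, y)) <=
    C%:E * ((\int[m1]_x H x) `^ be * (\int[m2]_y F y) `^ al).

(** For [H] and [F] of integral at most 1, the summand 1 bounds the double integral of [H * F], the
    first bracket that of the series in [F], the second that of the series in [H]. *)
Definition hls_const : \bar R :=
  let W w := \sum_(j <oo) ((w j).1 * (2 * (w j).2))%:E in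
  let kap c := ((2 - al - be) / (1 - c))%R in
  1 + (W (wsmall (2 - al - be)) + W (wlarge (kap be)))
    + (W (wsmall (2 - al - be)) + W (wlarge (kap al))).

Section weak_type.
Context d1 d2 (X : measurableType d1) (Y : measurableType d2).
Variable m1 : {sigma_finite_measure set X -> \bar R}.
Variable m2 : {sigma_finite_measure set Y -> \bar R}.
Variable D : X * Y -> R.
Hypotheses (al0 : (0 < al)%R) (al1 : (al < 1)%R) (be0 : (0 < be)%R)
  (be1 : (be < 1)%R) (albe : (1 < al + be)%R).
Hypotheses (mD : measurable_fun setT D) (D0 : forall z, (0 <= D z)%R).
Hypothesis D1 : forall x (r : R), (0 <= r)%R ->
  m2 [set y | (D (x, y) <= r)%R] <= (2 * r)%:E.
Hypothesis D2 : forall y (r : R), (0 <= r)%R ->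
  m1 [set x | (D (x, y) <= r)%R] <= (2 * r)%:E.

Let kernel_measurable (H : X -> \bar R) (F : Y -> \bar R) :
  measurable_fun setT H -> measurable_fun setT F ->
  measurable_fun setT (fun z : X * Y =>
     H z.1 `^ be * F z.2 `^ al * riesz (2 - al - be) (D z)).
Proof.
move=> mH mF; apply: emeasurable_funM; last first.
  by apply: measurableT_comp mD; exact: measurable_riesz.
apply: emeasurable_funM; apply: (measurableT_comp (measurable_poweR _)).
- exact: measurableT_comp.
- exact: measurableT_comp.
Qed.

Lemma weak_type_bilinear_normalized (H : X -> \bar R) (F : Y -> \bar R) :
  measurable_fun setT H -> measurable_fun setT F ->
  (forall x, 0 <= H x) -> (forall y, 0 <= F y) ->
  \int[m1]_x H x <= 1 -> \int[m2]_y F y <= 1 ->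
  \int[m1]_x \int[m2]_y (H x `^ be * F y `^ al * riesz (2 - al - be) (D (x, y)))
    <= hls_const.
Proof.
move=> mH mF H0 F0 iH iF.
pose w1 := wsmall (2 - al - be).
pose w2 c := wlarge ((2 - al - be) / (1 - c)).
have w10 j : (0 <= (w1 j).1)%R by exact: expR_ge0.
have w20 c j : (0 <= (w2 c j).1)%R by exact: expR_ge0.
pose G1 (z : X * Y) := H z.1 * F z.2.
pose G2 w (z : X * Y) := level_series w (F z.2) (D z).
pose G3 w (z : X * Y) := level_series w (H z.1) (D z).
have mH' : measurable_fun setT (fun z : X * Y => H z.1) by exact: measurableT_comp.
have mF' : measurable_fun setT (fun z : X * Y => F z.2) by exact: measurableT_comp.
have mG1 : measurable_fun setT G1 by exact: emeasurable_funM.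
have mG2 w : (forall j, 0 <= (w j).1)%R -> measurable_fun setT (G2 w).
  by move=> w0; exact: measurable_level_series.
have mG3 w : (forall j, 0 <= (w j).1)%R -> measurable_fun setT (G3 w).
  by move=> w0; exact: measurable_level_series.
have G10 z : 0 <= G1 z by exact: mule_ge0.
have G20 w : (forall j, 0 <= (w j).1)%R -> forall z, 0 <= G2 w z.
  by move=> w0 z; exact: level_series_ge0.
have G30 w : (forall j, 0 <= (w j).1)%R -> forall z, 0 <= G3 w z.
  by move=> w0 z; exact: level_series_ge0.
have iG1 : \int[prod_measure m1 m2]_z G1 z <= 1.
  rewrite integral_prod_measure// /G1 /=.
  under eq_integral do rewrite ge0_integralZl//.
  rewrite ge0_integralZr//; last by apply: integral_ge0 => y _.
  rewrite -[leRHS]mule1; apply: lee_pmul => //.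
  - by apply: integral_ge0 => y _.
  - by apply: integral_ge0 => y _.
have iG2 w : (forall j, 0 < (w j).1)%R -> (forall j, 0 < (w j).2)%R ->
    \int[prod_measure m1 m2]_z G2 w z <=
    \sum_(j <oo) ((w j).1 * (2 * (w j).2))%:E.
  move=> w0 w0'; have w0_ j : (0 <= (w j).1)%R := ltW (w0 j).
  (* [F y] is constant in [x], so integrating in [x] first involves only the sublevel sets of the
     distance. *)
  rewrite integral_prod_measure_swap//; [|exact: mG2|exact: G20].
  have S0 : 0 <= \sum_(j <oo) ((w j).1 * (2 * (w j).2))%:E.
    by apply: nneseries_ge0 => j _ _; rewrite lee_fin mulr_ge0// mulr_ge0// ltW.
  apply: (@le_trans _ _ (\int[m2]_y ((\sum_(j <oo) ((w j).1 * (2 * (w j).2))%:E) * F y))).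
    apply: ge0_le_integral => //.
    - by move=> y _; apply: integral_ge0 => x _; exact: G20.
    - by apply: measurable_integral_section2; [exact: mG2|exact: G20].
    - exact: measurable_funeM.
    - move=> y _.
      exact: (@integral_level_series R _ X m1 (fun x => D (x, y))
        (measurable_section2 y mD) (D2 y) w (F y) (F0 y) w0 w0').
  rewrite ge0_integralZl//.
  by rewrite -[leRHS]mule1 lee_wpmul2l.
have iG3 w : (forall j, 0 < (w j).1)%R -> (forall j, 0 < (w j).2)%R ->
    \int[prod_measure m1 m2]_z G3 w z <=
    \sum_(j <oo) ((w j).1 * (2 * (w j).2))%:E.
  move=> w0 w0'; have w0_ j : (0 <= (w j).1)%R := ltW (w0 j).
  rewrite integral_prod_measure//; [|exact: mG3|exact: G30].
  have S0 : 0 <= \sum_(j <oo) ((w j).1 * (2 * (w j).2))%:E.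
    by apply: nneseries_ge0 => j _ _; rewrite lee_fin mulr_ge0// mulr_ge0// ltW.
  apply: (@le_trans _ _ (\int[m1]_x ((\sum_(j <oo) ((w j).1 * (2 * (w j).2))%:E) * H x))).
    apply: ge0_le_integral => //.
    - by move=> y _; apply: integral_ge0 => x _; exact: G30.
    - by apply: measurable_integral_section; [exact: mG3|exact: G30].
    - exact: measurable_funeM.
    - move=> x _.
      exact: (@integral_level_series R _ Y m2 (fun y => D (x, y))
        (measurable_section1 x mD) (D1 x) w (H x) (H0 x) w0 w0').
  rewrite ge0_integralZl//.
  by rewrite -[leRHS]mule1 lee_wpmul2l.
pose G z := G1 z + (G2 w1 z + G2 (w2 be) z) + (G3 w1 z + G3 (w2 al) z).
have mG : measurable_fun setT G.
  apply: emeasurable_funD; last by apply: emeasurable_funD; exact: mG3.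
  by apply: emeasurable_funD => //; apply: emeasurable_funD; exact: mG2.
have G0 z : 0 <= G z by rewrite /G !adde_ge0// ?G20 ?G30.
apply: (@le_trans _ _ (\int[prod_measure m1 m2]_z G z)).
  rewrite integral_prod_measure//.
  have mK := kernel_measurable mH mF.
  have K0 z : 0 <= H z.1 `^ be * F z.2 `^ al * riesz (2 - al - be) (D z).
    by rewrite !mule_ge0 ?poweR_ge0 ?riesz_ge0.
  apply: ge0_le_integral => //.
  - by move=> x _; apply: integral_ge0 => y _; exact: (K0 (x, y)).
  - exact: (measurable_integral_section m2 mK K0).
  - exact: measurable_integral_section.
  - move=> x _; apply: ae_ge0_le_integral => //.
    + by move=> y _; exact: (K0 (x, y)).
    + exact: (measurable_section1 _ mK).
    + exact: measurable_section1.
    (* The diagonal, where the kernel is [+oo], is null by [D1] at [r = 0]; off it the pointwise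
       bound applies. *)
    + have Dx0 : measurable [set y | (D (x, y) <= 0)%R].
        under eq_set do rewrite -lee_fin.
        rewrite -[X in measurable X]setTI; apply: measurable_lee => //.
        by apply/measurable_EFinP; exact: measurable_section1.
      exists [set y | (D (x, y) <= 0)%R]; split => //.
      * have := D1 x (lexx 0%R); rewrite mulr0 => m0.
        by apply/eqP; rewrite eq_le m0 measure_ge0.
      * move=> y /=; apply: contra_notP => /negP; rewrite -ltNge => Dxy _.
        exact: riesz_trilinear_le.
have D2G w w' : (forall j, 0 <= (w j).1)%R -> (forall j, 0 <= (w' j).1)%R ->
    \int[prod_measure m1 m2]_z (G2 w z + G2 w' z) =
    \int[prod_measure m1 m2]_z G2 w z + \int[prod_measure m1 m2]_z G2 w' z.
  move=> w_0 w'_0; apply: ge0_integralD => //.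
  - by move=> z _; exact: G20.
  - exact: mG2.
  - by move=> z _; exact: G20.
  - exact: mG2.
have D3G w w' : (forall j, 0 <= (w j).1)%R -> (forall j, 0 <= (w' j).1)%R ->
    \int[prod_measure m1 m2]_z (G3 w z + G3 w' z) =
    \int[prod_measure m1 m2]_z G3 w z + \int[prod_measure m1 m2]_z G3 w' z.
  move=> w_0 w'_0; apply: ge0_integralD => //.
  - by move=> z _; exact: G30.
  - exact: mG3.
  - by move=> z _; exact: G30.
  - exact: mG3.
have mG22 : measurable_fun setT (fun z => G2 w1 z + G2 (w2 be) z).
  by apply: emeasurable_funD; exact: mG2.
have mG33 : measurable_fun setT (fun z => G3 w1 z + G3 (w2 al) z).
  by apply: emeasurable_funD; exact: mG3.
have G220 z : 0 <= G2 w1 z + G2 (w2 be) z by rewrite adde_ge0 ?G20.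
have G330 z : 0 <= G3 w1 z + G3 (w2 al) z by rewrite adde_ge0 ?G30.
rewrite /G (ge0_integralD _ _ (f1 := fun z => G1 z + (G2 w1 z + G2 (w2 be) z)))//; last 2 first.
- by move=> z _; rewrite adde_ge0.
- exact: emeasurable_funD.
rewrite (ge0_integralD _ _ (f1 := G1))// D2G// D3G//.
by apply: leeD; [apply: leeD => //; apply: leeD; apply: iG2 => j; exact: expR_gt0|
   apply: leeD; apply: iG3 => j; exact: expR_gt0].
Qed.

(** Since [2 - al - be = (1 - al) + (1 - be)] with both summands positive, dividing by either one
    gives a quotient above 1; [2 - al - be < 1] is [albe]. *)
Lemma hls_const_fin : hls_const \is a fin_num.
Proof.
have W0 (w : nat -> R * R) : (forall j, 0 <= (w j).1)%R ->
    (forall j, 0 <= (w j).2)%R ->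
    0 <= \sum_(j <oo) ((w j).1 * (2 * (w j).2))%:E.
  by move=> w1 w2; apply: nneseries_ge0 => j _ _; rewrite lee_fin !mulr_ge0.
rewrite ge0_fin_numE; last by rewrite /hls_const !adde_ge0 ?W0// => j;
  exact: expR_ge0.
have k c c' : (c < 1 -> c' < 1 -> 2 - al - be = 1 - c + (1 - c') ->
   1 < (2 - al - be) / (1 - c))%R.
  by move=> c1 c1' ->; rewrite ltr_pdivlMr ?mul1r ?ltrDl ?subr_gt0.
have S1 := @wsmall_summable R (2 - al - be).
have S2 := @wlarge_summable R.
have l1 : (2 - al - be < 1)%R by rewrite !ltrBlDr -addrA (addrC be) (_ : 2 = 1 + 1)%R// ltrD2l.
have ka : (1 < (2 - al - be) / (1 - al))%R.
  by apply: (k _ be) => //; ring.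
have kb : (1 < (2 - al - be) / (1 - be))%R.
  by apply: (k _ al) => //; ring.
by rewrite /hls_const; apply: lte_add_pinfty; [apply: lte_add_pinfty; first exact: ltry|];
  apply: lte_add_pinfty; (exact: S1 || exact: S2).
Qed.

Lemma hls_const_gt0 : 0 < hls_const.
Proof.
have W0 (w : nat -> R * R) : (forall j, 0 <= (w j).1)%R ->
    (forall j, 0 <= (w j).2)%R ->
    0 <= \sum_(j <oo) ((w j).1 * (2 * (w j).2))%:E.
  by move=> w1 w2; apply: nneseries_ge0 => j _ _; rewrite lee_fin !mulr_ge0.
rewrite /hls_const -addeA (lt_le_trans lte01)// leeDl// !adde_ge0 ?W0// => j;
  exact: expR_ge0.
Qed.

(** Both sides are homogeneous of degree [be] in [H] and [al] in [F], so dividing by the integrals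
    gives the normalized case. Integrals equal to 0 or [+oo] are settled beforehand, zero first:
    against an infinite integral it makes the right side [0 * +oo = 0], so the left side must be
    shown to vanish. *)
Lemma weak_type_bilinear :
  bilinear_bound m1 m2 (fun z => riesz (2 - al - be) (D z)) (fine hls_const).
Proof.
move=> H F mH mF H0 F0; rewrite fineK ?hls_const_fin//.
have K0 x y : 0 <= H x `^ be * F y `^ al * riesz (2 - al - be) (D (x, y)).
  by rewrite !mule_ge0 ?poweR_ge0 ?riesz_ge0.
have C0 := hls_const_gt0.
have mK := kernel_measurable mH mF.
have K0' z : 0 <= H z.1 `^ be * F z.2 `^ al * riesz (2 - al - be) (D z).
  by rewrite !mule_ge0 ?poweR_ge0 ?riesz_ge0.
have iH0 : 0 <= \int[m1]_x H x by apply: integral_ge0 => x _.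
have iF0 : 0 <= \int[m2]_y F y by apply: integral_ge0 => y _.
have [iH|iHn0] := eqVneq (\int[m1]_x H x) 0.
  rewrite (_ : \int[m1]_x _ = 0) ?mule_ge0 ?poweR_ge0 ?(ltW C0)//.
  rewrite (@ge0_ae_eq_integral _ _ _ m1 setT _ (cst 0)) ?integral0//.
  - exact: (measurable_integral_section m2 mK K0').
  - by move=> x _; apply: integral_ge0.
  - have : \int[m1]_x `|H x| = 0 by under eq_integral do rewrite gee0_abs//.
    move/(ae_eq_integral_abs m1 measurableT mH).
    apply: filterS => x /= Hx _; rewrite integral0_eq// => y _.
    by rewrite Hx// poweR0r ?gt_eqF// !mul0e.
have [iF|iFn0] := eqVneq (\int[m2]_y F y) 0.
  rewrite (_ : \int[m1]_x _ = 0) ?mule_ge0 ?poweR_ge0 ?(ltW C0)//.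
  rewrite integral0_eq// => x _.
  rewrite (@ge0_ae_eq_integral _ _ _ m2 setT _ (cst 0)) ?integral0//.
  - exact: (measurable_section1 _ mK).
  - have : \int[m2]_x `|F x| = 0 by under eq_integral do rewrite gee0_abs//.
    move/(ae_eq_integral_abs m2 measurableT mF).
    apply: filterS => y /= Fy _.
    by rewrite Fy// poweR0r ?gt_eqF// mule0 mul0e.
have iHp : 0 < \int[m1]_x H x by rewrite lt0e iHn0.
have iFp : 0 < \int[m2]_x F x by rewrite lt0e iFn0.
have [iHy|iHy] := eqVneq (\int[m1]_x H x) +oo.
  rewrite iHy poweRyr ?gt_eqF// gt0_mulye ?poweR_gt0//.
  by rewrite [leRHS]gt0_muley ?leey.
have [iFy|iFy] := eqVneq (\int[m2]_y F y) +oo.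
  rewrite iFy poweRyr ?gt_eqF// gt0_muley ?poweR_gt0//.
  by rewrite [leRHS]gt0_muley ?leey.
move: iHp iHy iFp iFy.
move EA : (\int[m1]_x H x) => A; move EB : (\int[m2]_y F y) => B.
move=> A0 Ay B0 By.
have [a Aa] : exists a, A = a%:E.
  by move: A A0 Ay {EA} => [a| |]// _ _; exists a.
have [b Bb] : exists b, B = b%:E.
  by move: B B0 By {EB} => [b| |]// _ _; exists b.
rewrite {}Aa in EA A0 *; rewrite {}Bb in EB B0 *.
move: A0 B0; rewrite !lte_fin => a0 b0 {Ay By}.
have a1 : 0 <= a^-1%:E by rewrite lee_fin invr_ge0 ltW.
have b1 : 0 <= b^-1%:E by rewrite lee_fin invr_ge0 ltW.
have := @weak_type_bilinear_normalized (fun x => a^-1%:E * H x) (fun y => b^-1%:E * F y).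
rewrite !ge0_integralZl// EA EB -!EFinM !mulVf ?gt_eqF// => N.
have {}N := N (measurable_funeM _ mH) (measurable_funeM _ mF)
  (fun x => mule_ge0 a1 (H0 x)) (fun x => mule_ge0 b1 (F0 x)) (lexx _) (lexx _).
have -> : \int[m1]_x \int[m2]_y
    (H x `^ be * F y `^ al * riesz (2 - al - be) (D (x, y))) =
    (a `^ be * b `^ al)%:E * \int[m1]_x \int[m2]_y ((a^-1%:E * H x) `^ be *
      (b^-1%:E * F y) `^ al * riesz (2 - al - be) (D (x, y))).
  have mK' := kernel_measurable (measurable_funeM a^-1%:E mH) (measurable_funeM b^-1%:E mF).
  have K0'' z : 0 <= (a^-1%:E * H z.1) `^ be * (b^-1%:E * F z.2) `^ al * riesz (2 - al - be) (D z).
    by rewrite !mule_ge0 ?poweR_ge0 ?riesz_ge0.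
  rewrite -ge0_integralZl//; last 3 first.
  - exact: (measurable_integral_section m2 mK' K0'').
  - by move=> x _; apply: integral_ge0 => y _; exact: (K0'' (x, y)).
  - by rewrite lee_fin mulr_ge0// powR_ge0.
  apply: eq_integral => x _.
  rewrite -ge0_integralZl//; last 3 first.
  - exact: (measurable_section1 _ mK').
  - by move=> y _; exact: (K0'' (x, y)).
  - by rewrite lee_fin mulr_ge0// powR_ge0.
  apply: eq_integral => y _.
  rewrite !muleA; congr (_ * _).
  rewrite !poweRM// !poweR_EFin.
  rewrite [RHS](_ : _ = ((a `^ be * a^-1 `^ be)%:E * H x `^ be) *
     ((b `^ al * b^-1 `^ al)%:E * F y `^ al)); last first.
    rewrite !EFinM -[LHS]muleA [X in _ * X = _]muleACA [LHS]muleA.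
    by rewrite [X in X * _ = _]muleACA [RHS]muleACA.
  rewrite -!powRM ?invr_ge0 ?(ltW a0) ?(ltW b0)//.
  by rewrite !divff ?gt_eqF// !powR1 !mul1e.
rewrite muleC lee_wpmul2r// lee_fin.
by rewrite mulr_ge0// powR_ge0.
Qed.

End weak_type.
End bilinear.

(** * Tensorization *)

Ltac measurable_proj := repeat first
  [ exact: measurable_fst | exact: measurable_snd | exact: measurable_id
  | exact: measurable_cst
  | apply: measurable_fun_pair
  | apply: (measurableT_comp measurable_fst)
  | apply: (measurableT_comp measurable_snd)].

Section bilinear_prod.
Local Open Scope ereal_scope.
Context (R : realType) (al be : R).
Context d1 d2 d3 d4 (X1 : measurableType d1) (Y1 : measurableType d2)
  (X2 : measurableType d3) (Y2 : measurableType d4).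
Variable m1 : {sigma_finite_measure set X1 -> \bar R}.
Variable m2 : {sigma_finite_measure set Y1 -> \bar R}.
Variable n1 : {sigma_finite_measure set X2 -> \bar R}.
Variable n2 : {sigma_finite_measure set Y2 -> \bar R}.
Variables (K1 : X1 * Y1 -> \bar R) (K2 : (X1 * Y1) * (X2 * Y2) -> \bar R).
Hypotheses (mK1 : measurable_fun setT K1) (K10 : forall z, 0 <= K1 z).
Hypotheses (mK2 : measurable_fun setT K2) (K20 : forall z, 0 <= K2 z).

(** With [(x1, y1)] frozen, the second bound applied to the slices of [H] and [F] leaves the powers
    [be] and [al] of their partial integrals, exactly the form the first bound accepts. [K2] may
    depend on [(x1, y1)] as long as [C2] does not; this admits the twist. *)
Lemma bilinear_bound_prod (C1 C2 : R) : (0 <= C2)%R ->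
  bilinear_bound al be m1 m2 K1 C1 ->
  (forall z, bilinear_bound al be n1 n2 (fun w => K2 (z, w)) C2) ->
  bilinear_bound al be (prod_measure m1 n1) (prod_measure m2 n2)
    (fun z => K1 (z.1.1, z.2.1) * K2 ((z.1.1, z.2.1), (z.1.2, z.2.2)))
    (C2 * C1).
Proof.
move=> C20 B1 B2 H F mH mF H0 F0.
(* [psi] groups the variables by factor of the kernel, [phi] by function; Tonelli is used in both
   groupings. *)
pose psi (w : (X1 * Y1) * (X2 * Y2)) :=
  H (w.1.1, w.2.1) `^ be * F (w.1.2, w.2.2) `^ al * (K1 w.1 * K2 w).
have psi0 w : 0 <= psi w by rewrite !mule_ge0 ?poweR_ge0.
have mpsi : measurable_fun setT psi.
  apply: emeasurable_funM; last first.
    by apply: emeasurable_funM => //; apply: (measurableT_comp mK1).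
  by apply: emeasurable_funM; apply: (measurableT_comp (measurable_poweR _));
    [apply: (measurableT_comp mH)|apply: (measurableT_comp mF)]; measurable_proj.
pose phi (w : (X1 * X2) * (Y1 * Y2)) := psi ((w.1.1, w.2.1), (w.1.2, w.2.2)).
have mphi : measurable_fun setT phi.
  by apply: (measurableT_comp mpsi); measurable_proj.
have phi0 w : 0 <= phi w by exact: psi0.
pose H' x1 := \int[n1]_x2 H (x1, x2).
pose F' y1 := \int[n2]_y2 F (y1, y2).
have mH' : measurable_fun setT H' by exact: measurable_integral_section.
have mF' : measurable_fun setT F' by exact: measurable_integral_section.
have H'0 x : 0 <= H' x by exact: integral_ge0.
have F'0 x : 0 <= F' x by exact: integral_ge0.
have K1'0 z : 0 <= H' z.1 `^ be * F' z.2 `^ al * K1 z.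
  by rewrite !mule_ge0 ?poweR_ge0.
have mK1' : measurable_fun setT (fun z => H' z.1 `^ be * F' z.2 `^ al * K1 z).
  apply: emeasurable_funM => //.
  by apply: emeasurable_funM; apply: (measurableT_comp (measurable_poweR _));
    exact: measurableT_comp.
pose Psi z := \int[prod_measure n1 n2]_w psi (z, w).
have mPsi : measurable_fun setT Psi by exact: measurable_integral_section.
have Psi0 z : 0 <= Psi z by exact: integral_ge0.
have Psi_le z : Psi z <= C2%:E * (H' z.1 `^ be * F' z.2 `^ al * K1 z).
  case: z => x1 y1 /=; rewrite /Psi integral_prod_measure//; last first.
    exact: (measurable_section1 _ mpsi).
  rewrite /psi /=.
  pose th (w : X2 * Y2) := H (x1, w.1) `^ be * F (y1, w.2) `^ al * K2 ((x1, y1), w).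
  have th0 w : 0 <= th w by rewrite !mule_ge0 ?poweR_ge0.
  have mth : measurable_fun setT th.
    apply: emeasurable_funM; last by apply: (measurableT_comp mK2); measurable_proj.
    by apply: emeasurable_funM; apply: (measurableT_comp (measurable_poweR _));
      [apply: (measurableT_comp mH)|apply: (measurableT_comp mF)]; measurable_proj.
  have -> : \int[n1]_x \int[n2]_y (H (x1, x) `^ be * F (y1, y) `^ al *
       (K1 (x1, y1) * K2 (x1, y1, (x, y))))
     = K1 (x1, y1) * \int[n1]_x \int[n2]_y th (x, y).
    rewrite -ge0_integralZl//; last 2 first.
    - exact: measurable_integral_section.
    - by move=> x _; apply: integral_ge0.
    apply: eq_integral => x _.
    rewrite -ge0_integralZl//; last exact: (measurable_section1 _ mth).
    by apply: eq_integral => y _; rewrite /th muleCA.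
  rewrite muleA [leRHS]muleC; apply: lee_wpmul2l => //.
  apply: (B2 (x1, y1) (fun x2 => H (x1, x2)) (fun y2 => F (y1, y2))) => //.
  - exact: measurable_section1.
  - exact: measurable_section1.
have -> : \int[prod_measure m1 n1]_x \int[prod_measure m2 n2]_y
   (H x `^ be * F y `^ al * (K1 ((x, y).1.1, (x, y).2.1) *
     K2 ((x, y).1.1, (x, y).2.1, ((x, y).1.2, (x, y).2.2))))
  = \int[m1]_x1 \int[m2]_y1 Psi (x1, y1).
  transitivity (\int[prod_measure m1 n1]_x \int[prod_measure m2 n2]_y phi (x, y)).
    apply: eq_integral => -[x1 x2] _; apply: eq_integral => -[y1 y2] _.
    by rewrite /phi /psi.
  rewrite integral_prod_measure//; last 2 first.
  - exact: measurable_integral_section.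
  - by move=> x; apply: integral_ge0.
  apply: eq_integral => x1 _.
  (* The order x1, x2, y1, y2 has to become x1, y1, x2, y2: [chi] absorbs the innermost integral so
     that the two middle ones can be exchanged. *)
  pose chi (z : X2 * Y1) := \int[n2]_y2 phi ((x1, z.1), (z.2, y2)).
  have mchi : measurable_fun setT chi.
    apply: (@measurable_integral_section _ _ _ _ _ n2
      (fun w => phi ((x1, w.1.1), (w.1.2, w.2)))) => //.
    by apply: (measurableT_comp mphi); measurable_proj.
  have chi0 z : 0 <= chi z by exact: integral_ge0.
  transitivity (\int[n1]_x2 \int[m2]_y1 chi (x2, y1)).
    apply: eq_integral => x2 _; rewrite integral_prod_measure//.
    exact: (measurable_section1 _ mphi).
  rewrite -(integral_prod_measure n1 m2)// integral_prod_measure_swap//.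
  apply: eq_integral => y1 _; rewrite /Psi integral_prod_measure//.
  exact: (measurable_section1 _ mpsi).
apply: (@le_trans _ _ (\int[m1]_x1 \int[m2]_y1
    (C2%:E * (H' x1 `^ be * F' y1 `^ al * K1 (x1, y1))))).
  have mr : measurable_fun setT (fun z => C2%:E * (H' z.1 `^ be * F' z.2 `^ al * K1 z)).
    exact: measurable_funeM.
  have r0 z : 0 <= C2%:E * (H' z.1 `^ be * F' z.2 `^ al * K1 z).
    by rewrite mule_ge0 ?lee_fin.
  apply: ge0_le_integral => //.
  - by move=> x _; apply: integral_ge0.
  - exact: measurable_integral_section.
  - exact: (measurable_integral_section m2 mr r0).
  - move=> x _; apply: ge0_le_integral => //.
    + exact: measurable_section1.
    + exact: (measurable_section1 _ mr).
have -> : \int[m1]_x1 \int[m2]_y1 (C2%:E * (H' x1 `^ be * F' y1 `^ al * K1 (x1, y1)))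
    = C2%:E * \int[m1]_x1 \int[m2]_y1 (H' x1 `^ be * F' y1 `^ al * K1 (x1, y1)).
  rewrite -ge0_integralZl_EFin//; last 2 first.
  - by move=> x _; apply: integral_ge0 => y _; exact: (K1'0 (x, y)).
  - exact: (measurable_integral_section m2 mK1' K1'0).
  apply: eq_integral => x _.
  rewrite ge0_integralZl_EFin//.
    by move=> y _; exact: (K1'0 (x, y)).
  exact: (measurable_section1 _ mK1').
rewrite EFinM -muleA lee_wpmul2l ?lee_fin//.
rewrite !integral_prod_measure//.
exact: B1.
Qed.

End bilinear_prod.

Section line.
Local Open Scope ereal_scope.
Context (R : realType) (al be : R).
Hypotheses (al0 : (0 < al)%R) (al1 : (al < 1)%R) (be0 : (0 < be)%R)
  (be1 : (be < 1)%R) (albe : (1 < al + be)%R).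
Local Notation RM := (measurableTypeR R).
Local Notation leb := (@lebesgue_measure R).

(** In each variable the sublevel sets of the distance are intervals of length [2 r] whatever [c]
    is, so the constant does not depend on [c]. *)
Lemma line_bilinear (c : R) :
  bilinear_bound al be leb leb
    (fun z : RM * RM => riesz (2 - al - be) `|(z.1 : R) - z.2 + c|%R) (fine (hls_const al be)).
Proof.
have itv1 (x r : R) : (0 <= r)%R -> leb `[(x - r)%R, (x + r)%R]%classic <= (2 * r)%:E.
  move=> r0; rewrite lebesgue_measure_itv /=; case: ifPn => _; rewrite ?lee_fin ?mulr_ge0//.
  by lra.
apply: (weak_type_bilinear (D := fun z : RM * RM => `|(z.1 : R) - z.2 + c|%R)) => //.
- apply: measurableT_comp => //; apply: measurable_funD => //.
  exact: measurable_funB.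
- move=> x r r0; apply: le_trans (itv1 (x + c)%R r r0).
  rewrite le_eqVlt; apply/orP; left; apply/eqP; congr (leb _).
  by apply/seteqP; split => y /=; rewrite in_itv /= ler_norml => /andP[? ?];
    apply/andP; split; lra.
- move=> y r r0; apply: le_trans (itv1 (y - c)%R r r0).
  rewrite le_eqVlt; apply/orP; left; apply/eqP; congr (leb _).
  by apply/seteqP; split => x /=; rewrite in_itv /= ler_norml => /andP[? ?];
    apply/andP; split; lra.
Qed.
End line.

Section tuples.
Local Open Scope ereal_scope.
Context (R : realType) (al be : R).
Hypotheses (al0 : (0 < al)%R) (al1 : (al < 1)%R) (be0 : (0 < be)%R)
  (be1 : (be < 1)%R) (albe : (1 < al + be)%R).
Local Notation RM := (measurableTypeR R).
Local Notation leb := (@lebesgue_measure R).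

Lemma integral_cons_measure n (m : {sigma_finite_measure set (n.-tuple RM) -> \bar R})
    (f : n.+1.-tuple RM -> \bar R) :
  measurable_fun setT f -> (forall x, 0 <= f x) ->
  \int[cons_measure m]_x f x = \int[prod_measure leb m]_p f (tuple_cons p).
Proof.
move=> mf f0.
rewrite (ge0_integral_pushforward (@measurable_tuple_cons R n))//.
Qed.

Lemma integral_lebesgue_tupleS n (f : n.+1.-tuple RM -> \bar R) :
  measurable_fun setT f -> (forall x, 0 <= f x) ->
  \int[lebesgue_tuple R n.+1]_x f x =
  \int[prod_measure leb (lebesgue_tuple R n)]_p f (tuple_cons p).
Proof. exact: integral_cons_measure. Qed.

Definition tuple_riesz (lam : R) n (z : n.-tuple RM * n.-tuple RM) : \bar R :=
  \big[*%E/1]_(i < n) riesz lam `|(tnth z.1 i : R) - tnth z.2 i|%R.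

Lemma tuple_riesz_ge0 lam n z : 0 <= @tuple_riesz lam n z.
Proof.
rewrite /tuple_riesz; elim/big_ind : _ => // [x y|i _]; first exact: mule_ge0.
exact: riesz_ge0.
Qed.

Lemma measurable_tuple_riesz lam n : measurable_fun setT (@tuple_riesz lam n).
Proof.
rewrite /tuple_riesz; elim: (index_enum _) => [|i r IH].
  under eq_fun do rewrite big_nil.
  exact: measurable_cst.
under eq_fun do rewrite big_cons.
apply: emeasurable_funM => //.
apply: (measurableT_comp (@measurable_riesz R lam)).
apply: measurableT_comp => //; apply: measurable_funB.
- by apply: (measurableT_comp (measurable_tnth i)); exact: measurable_fst.
- by apply: (measurableT_comp (measurable_tnth i)); exact: measurable_snd.
Qed.

(** The summand [+ 0] puts the head factor in the shape of [line_bilinear] at [c = 0]. *)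
Lemma tuple_riesz_cons lam n (p q : RM * n.-tuple RM) :
  tuple_riesz lam (tuple_cons p, tuple_cons q) =
  riesz lam `|(p.1 : R) - q.1 + 0|%R * tuple_riesz lam (p.2, q.2).
Proof.
rewrite /tuple_riesz big_ord_recl /= !tnth0 addr0; congr (_ * _).
by apply: eq_bigr => i _; rewrite !tnthS.
Qed.

Lemma tuple_bilinear n : bilinear_bound al be (lebesgue_tuple R n) (lebesgue_tuple R n)
  (@tuple_riesz (2 - al - be) n) ((fine (hls_const al be)) ^+ n).
Proof.
have C0 : (0 <= fine (hls_const al be))%R.
  by rewrite fine_ge0// ltW// hls_const_gt0.
have jointm n' (H F : n'.-tuple RM -> \bar R) :
    measurable_fun setT H -> measurable_fun setT F ->
    measurable_fun setT (fun z : n'.-tuple RM * n'.-tuple RM =>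
      H z.1 `^ be * F z.2 `^ al * tuple_riesz (2 - al - be) z).
  move=> mH mF; apply: emeasurable_funM; last exact: measurable_tuple_riesz.
  apply: emeasurable_funM; apply: (measurableT_comp (measurable_poweR _)).
  - exact: measurableT_comp.
  - exact: measurableT_comp.
have joint0 n' (H F : n'.-tuple RM -> \bar R) z :
    0 <= H z.1 `^ be * F z.2 `^ al * tuple_riesz (2 - al - be) z.
  by rewrite !mule_ge0 ?poweR_ge0 ?tuple_riesz_ge0.
elim: n => [|n IH] H F mH mF H0 F0.
  (* In dimension 0 the measure is a Dirac mass and the kernel an empty product, so both sides are
     the same value at one point. *)
  have mK := jointm _ _ _ mH mF.
  have mKi := measurable_integral_section (lebesgue_tuple R 0) mK (joint0 _ H F).
  rewrite /= integral_dirac//.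
  rewrite integral_dirac//; last exact: (measurable_section1 _ mK).
  rewrite !integral_dirac// !diracE !in_setT !mul1e ?expr0 ?mul1e.
  by rewrite /tuple_riesz big_ord0 mule1.
have mK := jointm _ _ _ mH mF.
have mKi := measurable_integral_section (lebesgue_tuple R n.+1) mK (joint0 _ H F).
rewrite !integral_lebesgue_tupleS//;
  last by move=> x; apply: integral_ge0 => y _; exact: (joint0 _ H F (x, y)).
under eq_integral => p _.
  rewrite integral_lebesgue_tupleS; last 2 first.
  - exact: (measurable_section1 _ mK).
  - by move=> y; exact: (joint0 _ H F (tuple_cons p, y)).
  under eq_integral do rewrite tuple_riesz_cons.
  over.
have tc := @measurable_tuple_cons R n.
have -> : (fine (hls_const al be) ^+ n.+1 =
  fine (hls_const al be) ^+ n * fine (hls_const al be))%R by rewrite exprSr.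
pose K1 (z : RM * RM) := riesz (2 - al - be) `|(z.1 : R) - z.2 + 0|%R.
pose K2 (w : (RM * RM) * (n.-tuple RM * n.-tuple RM)) := tuple_riesz (2 - al - be) w.2.
have mK1 : measurable_fun setT K1.
  apply: (measurableT_comp (@measurable_riesz R _)); apply: measurableT_comp => //.
  by apply: measurable_funD => //; exact: measurable_funB.
have mK2 : measurable_fun setT K2.
  by apply: (measurableT_comp (@measurable_tuple_riesz _ _)); exact: measurable_snd.
have K10 z : 0 <= K1 z by exact: riesz_ge0.
have K20 z : 0 <= K2 z by exact: tuple_riesz_ge0.
have := @bilinear_bound_prod R al be _ _ _ _ RM RM _ _ leb leb (lebesgue_tuple R n)
  (lebesgue_tuple R n) K1 K2 mK1 K10 mK2 K20 (fine (hls_const al be))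
  (fine (hls_const al be) ^+ n) (exprn_ge0 _ C0)
  (line_bilinear al0 al1 be0 be1 albe 0) (fun=> IH) (H \o @tuple_cons R n)
  (F \o @tuple_cons R n).
apply.
- exact: measurableT_comp.
- exact: measurableT_comp.
- by move=> x; exact: H0.
- by move=> x; exact: F0.
Qed.
End tuples.

(** * Domination of the kernel *)

Section kernel_domination.
Context (R : realType) (n : nat) (a b g : R).
Hypotheses (nb : n%:R * b <= a) (g1 : g < 1).
Hypothesis gE : g * (n%:R + 1) = a + b.
Local Notation Rn := (n.-tuple (measurableTypeR R)).

Let bg : b <= g.
Proof.
have n1 : 0 < n%:R + 1 :> R by rewrite ltr_wpDl.
by rewrite -(ler_pM2r n1) gE mulrDr mulr1 lerD2r mulrC.
Qed.

(** Homogeneity gives [n - a = n (1 - g) - (g - b)]. As [b <= g], the form in which [a >= n b]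
    enters, the surplus [s^(g - b)] is at most [(s + T)^(g - b)]; this turns the second factor into
    [(s + T)^(- (1 - g))], which is at most [T^(- (1 - g))]. *)
Lemma kernel_split (s T : R) : 0 < s -> 0 < T ->
  s^-1 `^ (n%:R - a) * (s + T)^-1 `^ (1 - b) <=
  (s `^ (- (1 - g))) ^+ n * T `^ (- (1 - g)).
Proof.
move=> s0 T0; have sT0 : 0 < s + T by exact: addr_gt0.
have [L sE] : exists L, s = expR L by exists (ln s); rewrite lnK.
have [M sTE] : exists L, s + T = expR L by exists (ln (s + T)); rewrite lnK.
have [t TE] : exists L, T = expR L by exists (ln T); rewrite lnK.
have LM : L <= M by rewrite -ler_expR -sE -sTE lerDl ltW.
have tM : t <= M by rewrite -ler_expR -TE -sTE lerDr ltW.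
rewrite sTE sE TE -!expRN -!expRM -expRM_natl -!expRD ler_expR.
have h1 := ler_wpM2l (_ : 0 <= g - b) LM.
have h2 := ler_wpM2l (_ : 0 <= 1 - g) tM.
have {}h1 := h1 _ ; have {h1} := h1 (ltac:(by rewrite subr_ge0)).
have {h2} := h2 (ltac:(by rewrite subr_ge0 ltW)).
move=> h2 h1.
have -> : - L * (n%:R - a) = - L * (n%:R * (1 - g)) + L * (g - b).
  have -> : a = g * (n%:R + 1) - b by rewrite gE addrK.
  by ring.
lra.
Qed.

Lemma tdot_ge0 (x : Rn) : 0 <= tdot x x.
Proof. by apply: sumr_ge0 => i _; rewrite -expr2 sqr_ge0. Qed.

Lemma tdot_ge_sq (x : Rn) i : (tnth x i : R) ^+ 2 <= tdot x x.
Proof.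
rewrite /tdot (bigD1 i)//= expr2 lerDl.
by apply: sumr_ge0 => j _; rewrite -expr2 sqr_ge0.
Qed.

Lemma ereal_prod_pinfty (I : finType) (F : I -> \bar R) i :
  (forall j, 0 < F j)%E -> F i = +oo%E -> (\big[*%E/1%E]_j F j = +oo)%E.
Proof.
move=> F0 Fi; rewrite (bigD1 i)//= Fi gt0_mulye//.
by elim/big_ind : _ => // x y x0 y0; exact: mule_gt0.
Qed.

Lemma riesz_gt0 (lam d : R) : 0 <= d -> (0 < riesz lam d)%E.
Proof.
move=> d0; rewrite /riesz; case: ifPn => // dn0.
by rewrite lte_fin powR_gt0// lt0r dn0.
Qed.

Lemma riesz_prod (lam : R) (F : 'I_n -> R) :
  (forall i, F i != 0) ->
  (\big[*%E/1%E]_i riesz lam `|F i| = (\prod_i `|F i| `^ (- lam))%:E)%E.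
Proof.
move=> F0; rewrite (big_morph EFin (op1 := *%E) (id1 := 1%E) EFinM)//.
by apply: eq_bigr => i _; rewrite /riesz normr_eq0 (negbTE (F0 i)).
Qed.

(** Where some coordinate vanishes, the right side is [+oo], its other factors being positive; this
    covers the points [xi = eta = 0], where the value of [Omega] is conventional. *)
Lemma Omega_le_riesz (z : heis R n) : (0 < n)%N ->
  ((Omega a b z)%:E <=
   (\big[*%E/1]_(i < n) riesz (1 - g) `|tnth z.1.1 i : R|%R *
    \big[*%E/1]_(i < n) riesz (1 - g) `|tnth z.1.2 i : R|%R) *
    riesz (1 - g) `|z.2 : R|%R)%E.
Proof.
move: z => [[xi eta] tau] n0 /=.
have R0 (d : R) : (0 < riesz (1 - g) `|d|)%E by exact: riesz_gt0.
have P0 (x : Rn) : (0 < \big[*%E/1]_(i < n) riesz (1 - g) `|tnth x i : R|%R)%E.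
  by elim/big_ind : _ => // x' y' x0 y0; exact: mule_gt0.
have Py (x : Rn) i : tnth x i = 0 ->
   (\big[*%E/1]_(i < n) riesz (1 - g) `|tnth x i : R|%R = +oo)%E.
  move=> xi0; apply: (@ereal_prod_pinfty _ _ i) => //.
  by rewrite xi0 /riesz normr0 eqxx.
have [[i xi0]|xi0] := pselect (exists i, tnth xi i = 0).
  by rewrite (Py _ _ xi0) gt0_mulye// gt0_mulye// leey.
have [[i eta0]|eta0] := pselect (exists i, tnth eta i = 0).
  by rewrite (Py _ _ eta0) gt0_muley// gt0_mulye// leey.
have [tau0|tau0] := eqVneq (tau : R) 0.
  have -> : riesz (1 - g) `|tau : R| = +oo%E by rewrite tau0 /riesz normr0 eqxx.
  by rewrite [X in (_ <= X)%E]gt0_muley ?leey// mule_gt0.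
have xin i : (tnth xi i : R) != 0 by apply/eqP => h; apply: xi0; exists i.
have etan i : (tnth eta i : R) != 0 by apply/eqP => h; apply: eta0; exists i.
rewrite !riesz_prod// /riesz normr_eq0 (negbTE tau0) -!EFinM lee_fin.
set s := tdot xi xi + tdot eta eta.
have sxi i : (tnth xi i : R) ^+ 2 <= s.
  by rewrite (le_trans (tdot_ge_sq xi i))// lerDl tdot_ge0.
have s0 : 0 < s.
  by apply: lt_le_trans (sxi (Ordinal n0)); rewrite exprn_even_gt0//= xin.
have T0 : 0 < `|tau : R| by rewrite normr_gt0.
apply: le_trans (kernel_split s0 T0) _.
(* One of the [n] factors [s^(- (1 - g))] is spent on each pair of coordinates [xi_i], [eta_i]. *)
rewrite ler_wpM2r ?powR_ge0// -big_split /=.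
rewrite -[X in _ ^+ X](card_ord n) -prodr_const.
apply: ler_prod => i _; rewrite powR_ge0 /= -powRM//.
rewrite !powRN lef_pV2 ?posrE ?powR_gt0// ?mulr_gt0 ?normr_gt0//.
rewrite ge0_ler_powR ?nnegrE ?mulr_ge0 ?subr_ge0 ?(ltW g1) ?(ltW s0)//.
rewrite (@le_trans _ _ (`|tnth xi i : R| ^+ 2 + `|tnth eta i : R| ^+ 2))//.
  by have := sqr_ge0 (`|tnth xi i : R| - `|tnth eta i : R|); nra.
by rewrite lerD// real_normK ?num_real// tdot_ge_sq.
Qed.

End kernel_domination.

(** * Measurability of the group law and of the kernel *)

Section measurability.
Context (R : realType) (n : nat) d (T : measurableType d).
Local Notation RM := (measurableTypeR R).
Local Notation Rn := (n.-tuple RM).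

Lemma measurable_tdot (f g : T -> Rn) :
  measurable_fun setT f -> measurable_fun setT g ->
  measurable_fun setT (fun t => tdot (f t) (g t)).
Proof.
move=> mf mg; apply: measurable_sum => i.
by apply: measurable_funM; exact: (measurableT_comp (measurable_tnth i)).
Qed.

Lemma measurable_tadd (f g : T -> Rn) :
  measurable_fun setT f -> measurable_fun setT g ->
  measurable_fun setT (fun t => tadd (f t) (g t)).
Proof.
move=> mf mg; apply/measurable_fun_tnthP => i.
rewrite (_ : _ \o _ = fun t => tnth (f t) i + tnth (g t) i : R); last first.
  by apply/funext => t /=; rewrite tnth_mktuple.
by apply: measurable_funD; exact: (measurableT_comp (measurable_tnth i)).
Qed.

Lemma measurable_topp (f : T -> Rn) :
  measurable_fun setT f -> measurable_fun setT (fun t => topp (f t)).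
Proof.
move=> mf; apply/measurable_fun_tnthP => i.
rewrite (_ : _ \o _ = fun t => - tnth (f t) i : R); last first.
  by apply/funext => t /=; rewrite tnth_mktuple.
by apply: measurableT_comp => //; exact: (measurableT_comp (measurable_tnth i)).
Qed.

Lemma measurable_heis_mul_inv (mu : R) (f g : T -> heis R n) :
  measurable_fun setT f -> measurable_fun setT g ->
  measurable_fun setT (fun t => heis_mul mu (f t) (heis_inv (g t))).
Proof.
move=> mf mg.
have mf1 : measurable_fun setT (fun t => (f t).1.1).
  by apply: (measurableT_comp measurable_fst); exact: (measurableT_comp measurable_fst).
have mf2 : measurable_fun setT (fun t => (f t).1.2).
  by apply: (measurableT_comp measurable_snd); exact: (measurableT_comp measurable_fst).
have mf3 : measurable_fun setT (fun t => (f t).2) by exact: (measurableT_comp measurable_snd).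
have mg1 : measurable_fun setT (fun t => topp (g t).1.1).
  apply: measurable_topp.
  by apply: (measurableT_comp measurable_fst); exact: (measurableT_comp measurable_fst).
have mg2 : measurable_fun setT (fun t => topp (g t).1.2).
  apply: measurable_topp.
  by apply: (measurableT_comp measurable_snd); exact: (measurableT_comp measurable_fst).
have mg3 : measurable_fun setT (fun t => (g t).2) by exact: (measurableT_comp measurable_snd).
rewrite (_ : (fun t => _) = fun t =>
  (tadd (f t).1.1 (topp (g t).1.1), tadd (f t).1.2 (topp (g t).1.2),
   ((f t).2 : R) + - ((g t).2 : R) + mu * (tdot (f t).1.1 (topp (g t).1.2) -
      tdot (f t).1.2 (topp (g t).1.1)) : measurableTypeR R)); last first.
  by apply/funext => t; case: (f t) => [[? ?] ?]; case: (g t) => [[? ?] ?].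
apply: measurable_fun_pair.
  by apply: measurable_fun_pair; exact: measurable_tadd.
apply: measurable_funD.
  by apply: measurable_funD => //; exact: measurableT_comp.
apply: measurable_funM => //.
by apply: measurable_funB; exact: measurable_tdot.
Qed.

End measurability.

Lemma measurable_Omega (R : realType) n (a b : R) :
  measurable_fun setT (@Omega R n a b).
Proof.
rewrite (_ : Omega _ _ = fun z =>
  ((tdot z.1.1 z.1.1 + tdot z.1.2 z.1.2) `^ (-1)) `^ (n%:R - a) *
  ((tdot z.1.1 z.1.1 + tdot z.1.2 z.1.2 + `|z.2 : R|) `^ (-1)) `^ (1 - b)); last first.
  apply/funext => -[[xi eta] tau] /=.
  have s0 : 0 <= tdot xi xi + tdot eta eta by rewrite addr_ge0 ?tdot_ge0.
  by rewrite !powR_inv1// addr_ge0.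
have m1 : measurable_fun setT (fun z : heis R n => tdot z.1.1 z.1.1 + tdot z.1.2 z.1.2).
  by apply: measurable_funD; apply: measurable_tdot; measurable_proj.
have mp (f : heis R n -> R) c : measurable_fun setT f -> measurable_fun setT (fun z => f z `^ c).
  by move=> mf; exact: (measurableT_comp (measurable_powR c)).
apply: measurable_funM; apply: (mp _ _); apply: (mp _ _) => //.
apply: measurable_funD => //; apply: measurableT_comp => //.
Qed.

Lemma Omega_ge0 (R : realType) n (a b : R) z : 0 <= @Omega R n a b z.
Proof. by case: z => [[? ?] ?]; rewrite mulr_ge0 ?powR_ge0. Qed.

(** * The bilinear bound on the group *)

Section heis_bilinear.
Local Open Scope ereal_scope.
Context (R : realType) (n : nat) (mu a b al be g : R).
Hypotheses (al0 : (0 < al)%R) (al1 : (al < 1)%R) (be0 : (0 < be)%R)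
  (be1 : (be < 1)%R) (albe : (1 < al + be)%R).
Hypotheses (n0 : (0 < n)%N) (nb : (n%:R * b <= a)%R).
Hypothesis (gE : (g * (n%:R + 1) = a + b)%R) (gab : (g = al + be - 1)%R).
Local Notation RM := (measurableTypeR R).
Local Notation leb := (@lebesgue_measure R).
Local Notation Rn := (n.-tuple RM).
Local Notation lam := (2 - al - be)%R.

Let shift (z : (Rn * Rn) * (Rn * Rn)) : R :=
  (mu * (tdot z.1.1 (topp z.2.2) - tdot z.1.2 (topp z.2.1)))%R.

Let Kuv (z : (Rn * Rn) * (Rn * Rn)) : \bar R :=
  tuple_riesz lam (z.1.1, z.2.1) * tuple_riesz lam (z.1.2, z.2.2).

Let Kt (w : ((Rn * Rn) * (Rn * Rn)) * (RM * RM)) : \bar R :=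
  riesz lam `|(w.2.1 : R) - w.2.2 + shift w.1|%R.

Let measurable_Kuv : measurable_fun setT Kuv.
Proof.
by apply: emeasurable_funM; apply: (measurableT_comp (@measurable_tuple_riesz _ _ _));
  measurable_proj.
Qed.

Let measurable_Kt : measurable_fun setT Kt.
Proof.
apply: (measurableT_comp (@measurable_riesz R _)); apply: measurableT_comp => //.
apply: measurable_funD.
  by apply: measurable_funB; measurable_proj.
apply: measurable_funM => //.
apply: measurable_funB; apply: measurable_tdot; try (by measurable_proj);
by apply: measurable_topp; measurable_proj.
Qed.

(** The last variable has to be the second factor of the tensorization: its kernel is the line
    kernel translated by [shift], a function of all the other variables. Each of the [2 n + 1]
    coordinates contributes one factor [C]. *)
Lemma heis_bilinear : exists C : R, (0 < C)%R /\
  bilinear_bound al be (lebesgue_heis R n) (lebesgue_heis R n)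
    (fun z => (Omega a b (heis_mul mu z.1 (heis_inv z.2)))%:E) C.
Proof.
have C0 : (0 < fine (hls_const al be))%R.
  by rewrite fine_gt0// hls_const_gt0//= -ge0_fin_numE ?hls_const_fin// ltW// hls_const_gt0.
pose C := fine (hls_const al be).
exists (C * (C ^+ n * C ^+ n))%R; split; first by rewrite !mulr_gt0 ?exprn_gt0.
have Kuv0 z : 0 <= Kuv z by rewrite mule_ge0 ?tuple_riesz_ge0.
have Kt0 z : 0 <= Kt z by exact: riesz_ge0.
have Buv : bilinear_bound al be
    (prod_measure (lebesgue_tuple R n) (lebesgue_tuple R n))
    (prod_measure (lebesgue_tuple R n) (lebesgue_tuple R n)) Kuv (C ^+ n * C ^+ n).
  pose K2 (w : (Rn * Rn) * (Rn * Rn)) := tuple_riesz lam w.2.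
  have mK2 : measurable_fun setT K2.
    by apply: (measurableT_comp (@measurable_tuple_riesz _ _ _)); measurable_proj.
  have K20 w : 0 <= K2 w by exact: tuple_riesz_ge0.
  have Q := (@bilinear_bound_prod R al be _ _ _ _ Rn Rn Rn Rn
    (lebesgue_tuple R n) (lebesgue_tuple R n) (lebesgue_tuple R n) (lebesgue_tuple R n)
    (@tuple_riesz R lam n) K2
    (@measurable_tuple_riesz R lam n) (@tuple_riesz_ge0 R lam n)
    mK2 K20 (C ^+ n) (C ^+ n) (exprn_ge0 _ (ltW C0)) (tuple_bilinear al0 al1 be0 be1 albe (n:=n))
    (fun=> tuple_bilinear al0 al1 be0 be1 albe (n:=n))).
  exact: Q.
have B := @bilinear_bound_prod R al be _ _ _ _ (Rn * Rn)%type (Rn * Rn)%type RM RM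
  (prod_measure (lebesgue_tuple R n) (lebesgue_tuple R n))
  (prod_measure (lebesgue_tuple R n) (lebesgue_tuple R n)) leb leb Kuv Kt
  measurable_Kuv Kuv0 measurable_Kt Kt0 _ _ (ltW C0) Buv
  (fun z => line_bilinear al0 al1 be0 be1 albe (shift z)).
move=> H F mH mF H0 F0.
apply: le_trans (B H F mH mF H0 F0).
pose K z := Kuv (z.1.1, z.2.1) * Kt (z.1.1, z.2.1, (z.1.2, z.2.2)).
have OK x y : (Omega a b (heis_mul mu x (heis_inv y)))%:E <= K (x, y).
  have g1 : (g < 1)%R by rewrite gab ltrBlDr ltrD.
  apply: le_trans (Omega_le_riesz nb g1 gE _ n0) _.
  case: x => [[u v] t]; case: y => [[xi eta] tau] /=.
  rewrite /K /Kuv /Kt /shift /tuple_riesz /= gab.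
  rewrite (_ : 1 - (al + be - 1) = lam)%R; last by ring.
  rewrite le_eqVlt; apply/orP; left; apply/eqP.
  by congr (_ * _ * _); apply: eq_bigr => i _; rewrite !tnth_mktuple.
have mOm : measurable_fun setT (fun z : heis R n * heis R n =>
    (Omega a b (heis_mul mu z.1 (heis_inv z.2)))%:E).
  apply/measurable_EFinP; apply: (measurableT_comp (@measurable_Omega _ _ _ _)).
  by apply: measurable_heis_mul_inv; measurable_proj.
have mK : measurable_fun setT K.
  by apply: emeasurable_funM; [apply: (measurableT_comp measurable_Kuv)|
    apply: (measurableT_comp measurable_Kt)]; measurable_proj.
have mHF : measurable_fun setT (fun z : heis R n * heis R n => H z.1 `^ be * F z.2 `^ al).
  by apply: emeasurable_funM; apply: (measurableT_comp (measurable_poweR _));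
    exact: measurableT_comp.
have m1 := emeasurable_funM mHF mOm; have m2 := emeasurable_funM mHF mK.
have HF0 x y : 0 <= H x `^ be * F y `^ al by rewrite mule_ge0 ?poweR_ge0.
have t1 z : 0 <= H z.1 `^ be * F z.2 `^ al * (Omega a b (heis_mul mu z.1 (heis_inv z.2)))%:E.
  by rewrite mule_ge0// lee_fin Omega_ge0.
have t2 z : 0 <= H z.1 `^ be * F z.2 `^ al * K z.
  by rewrite mule_ge0// /K mule_ge0.
apply: ge0_le_integral => //.
- by move=> x _; apply: integral_ge0 => y _; exact: (t1 (x, y)).
- exact: (measurable_integral_section (lebesgue_heis R n) m1 t1).
- exact: (measurable_integral_section (lebesgue_heis R n) m2 t2).
- move=> x _; apply: ge0_le_integral => //.
  + by move=> y _; exact: (t1 (x, y)).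
  + exact: (measurable_section1 _ m1).
  + exact: (measurable_section1 _ m2).
  + by move=> y _; exact: lee_wpmul2l.
Qed.

End heis_bilinear.

(** * Duality *)

Section duality.
Local Open Scope ereal_scope.
Context d (X : measurableType d) (R : realType).
Variable m : {sigma_finite_measure set X -> \bar R}.
Variables (q : R) (G : X -> \bar R) (A : R).
Hypotheses (q1 : (1 < q)%R) (mG : measurable_fun setT G) (G0 : forall x, 0 <= G x).
Hypothesis A0 : (0 <= A)%R.
Hypothesis dual : forall H : X -> \bar R, measurable_fun setT H ->
  (forall x, 0 <= H x) ->
  \int[m]_x (H x `^ (1 - q^-1) * G x) <= A%:E * (\int[m]_x H x) `^ (1 - q^-1).

Let q0 : (0 < q)%R. Proof. by rewrite (lt_trans _ q1). Qed.

(** With [t = min(g, N)], [t^q = t^(q - 1) t] and [t^(q - 1) = (t^q)^(1 - 1/q)]; only the last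
    factor [t] is enlarged to [g]. *)
Let trunc_le (g : \bar R) (N : nat) : 0 <= g ->
  let h := Order.min g N%:R%:E `^ q in h <= h `^ (1 - q^-1) * g.
Proof.
move=> g0 /=; set t := Order.min g _.
have t0 : 0 <= t by rewrite le_min g0 lee_fin /=.
have tg : t <= g by rewrite ge_min lexx.
rewrite -poweRrM mulrBr mulr1 divff ?gt_eqF//.
have {1}-> : q = (q - 1 + 1)%R by rewrite subrK.
rewrite poweRD; last by rewrite add_neq0_poweRD_def// subrK gt_eqF.
by rewrite poweRe1// lee_wpmul2l ?poweR_ge0.
Qed.

(** Cancelling [I^(1 - 1/q)], which needs [I] finite, leaves [I^(1/q) <= A]. *)
Let fin_le (I : \bar R) : 0 <= I -> I < +oo -> I <= A%:E * I `^ (1 - q^-1) ->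
  I <= A%:E `^ q.
Proof.
case: I => [r|//|//]; rewrite lee_fin le_eqVlt => /orP[/eqP<- _ _|r0 _].
  exact: poweR_ge0.
rewrite !poweR_EFin -EFinM !lee_fin => h.
have rA : (r `^ q^-1 <= A)%R.
  rewrite -(ler_pM2r (powR_gt0 (1 - q^-1) r0)) -powRD; last first.
    by rewrite (gt_eqF r0) implybT.
  by rewrite addrCA subrr addr0 powRr1 ?(ltW r0).
have := ge0_ler_powR (ltW q0) _ _ rA.
rewrite !nnegrE powR_ge0 => /(_ isT A0).
by rewrite -powRrM mulVf ?gt_eqF// powRr1// ltW.
Qed.

(* Tests the hypothesis on min(G, N)^q 1_(E_N), whose integral is finite, so that a power of
   it can be cancelled. *)
Lemma dual_integral_le : \int[m]_x G x `^ q <= A%:E `^ q.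
Proof.
have /sigma_finiteP[E [TE ndE Eoo]] := sigma_finiteT m.
have mE k : measurable (E k) by have [] := Eoo k.
pose H N x := Order.min (G x) N%:R%:E `^ q * (\1_(E N) x)%:E.
have H0 N x : 0 <= H N x by rewrite mule_ge0 ?poweR_ge0// lee_fin.
have mH N : measurable_fun setT (H N).
  apply: emeasurable_funM; last by apply/measurable_EFinP; exact: measurable_indic.
  apply: (measurableT_comp (measurable_poweR _)).
  exact: measurable_mine.
have minle N M x : (N <= M)%N -> Order.min (G x) N%:R%:E <= Order.min (G x) M%:R%:E.
  move=> NM; rewrite le_min ge_min lexx /= ge_min; apply/orP; right.
  by rewrite lee_fin ler_nat.
have min0 N x : 0 <= Order.min (G x) N%:R%:E by rewrite le_min G0 lee_fin /=.
have pmono (s t : \bar R) : 0 <= s -> s <= t -> s `^ q <= t `^ q.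
  move=> s0 st; apply: gt0_ler_poweR => //; first exact: ltW.
    by rewrite in_itv /= s0 leey.
  by rewrite in_itv /= (le_trans s0 st) leey.
have ndH x : {homo H ^~ x : N M / (N <= M)%N >-> N <= M}.
  move=> N M NM; apply: lee_pmul => //.
  - exact: poweR_ge0.
  - by apply: pmono => //; exact: minle.
  - rewrite lee_fin !indicE ler_nat; case: (boolP (x \in E N)) => //.
    rewrite inE => ENx; suff -> : x \in E M by [].
    by rewrite inE; move: x ENx; exact/subsetPset/ndE.
have IH N : \int[m]_x H N x <= A%:E `^ q.
  apply: fin_le.
  - exact: integral_ge0.
  - apply: (@le_lt_trans _ _ (\int[m]_x ((N%:R `^ q)%:E * (\1_(E N) x)%:E))).
      apply: ge0_le_integral => //.
      + by apply/measurable_EFinP; apply: measurable_funM => //; exact: measurable_indic.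
      + move=> x _; apply: lee_wpmul2r; first by rewrite lee_fin.
        by rewrite -poweR_EFin; apply: pmono => //; rewrite ge_min lexx orbT.
    rewrite ge0_integralZl_EFin ?powR_ge0//; last first.
      by apply/measurable_EFinP; exact: measurable_indic.
    rewrite integral_indic// setIT lte_mul_pinfty ?lee_fin ?powR_ge0//.
    by have [] := Eoo N.
  - apply: le_trans (dual (mH N) (H0 N)).
    apply: ge0_le_integral => //.
    + apply: emeasurable_funM => //.
      by apply: (measurableT_comp (measurable_poweR _)).
    + move=> x _; rewrite /H indicE; case: (x \in E N) => /=.
        by rewrite mule1; exact: trunc_le.
      by rewrite !mule0 mule_ge0 ?poweR_ge0.
apply: (@le_trans _ _ (\int[m]_x limn (H ^~ x))).
  apply: ge0_le_integral => //.
  - by move=> x _; exact: poweR_ge0.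
  - exact: (measurableT_comp (measurable_poweR _)).
  - apply: (emeasurable_fun_cvg H) => // x _.
    by apply: ereal_nondecreasing_is_cvgn => ? ?; exact: ndH.
  - move=> x _.
    have Hl N : H N x <= limn (H ^~ x).
      rewrite (cvg_lim _ (ereal_nondecreasing_cvgn (ndH x)))//.
      by apply: ereal_sup_ubound; exists N.
    have [k Ek] : exists k, E k x.
      have : [set: X] x by [].
      by rewrite TE => -[k _ Ek]; exists k.
    have EN N : (k <= N)%N -> \1_(E N) x = 1%R :> R.
      move=> kN; rewrite indicE mem_set//.
      by move: x Ek {Hl}; exact/subsetPset/ndE.
    have := G0 x; case Gx : (G x) => [r|//|//]; last first.
      (* If [G x = +oo] and the limit were a real [r], then an index [N] with [N >= k] and [N > r]
         would give [H N x = N^q >= N > r]. *)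
      move=> _; rewrite poweRyr ?gt_eqF// leNgt; apply/negP => Ly.
      have L0 : 0 <= limn (H ^~ x) by exact: le_trans (H0 0%N x) (Hl 0%N).
      have [r Lr] : exists r, limn (H ^~ x) = r%:E.
        by exists (fine (limn (H ^~ x))); rewrite fineK// ge0_fin_numE.
      have := Hl (maxn k (Num.truncn r).+1).
      rewrite Lr /H EN ?leq_maxl// mule1 Gx min_r ?leey// poweR_EFin lee_fin.
      apply/negP; rewrite -ltNge (lt_le_trans (truncnS_gt r))//.
      rewrite (@le_trans _ _ ((maxn k (Num.truncn r).+1)%:R)%R)// ?ler_nat ?leq_maxr//.
      by apply: le1r_powR; rewrite ?ler1n ?(ltW q1)// leq_max orbT.
    rewrite lee_fin => r0.
    have rN : (r <= (maxn k (Num.truncn r).+1)%:R)%R.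
      by rewrite (le_trans (ltW (truncnS_gt r)))// ler_nat leq_maxr.
    apply: le_trans (Hl (maxn k (Num.truncn r).+1)).
    by rewrite /H EN ?leq_maxl// mule1 Gx min_l ?lee_fin.
rewrite monotone_convergence//.
apply: lime_le; last by apply: nearW => N; exact: IH.
by apply: ereal_nondecreasing_is_cvgn => M N MN; apply: ge0_le_integral => // x _; exact: ndH.
Qed.
End duality.

(** * From the bilinear bound to the norm inequality *)

Section sufficiency.
Local Open Scope ereal_scope.
Context (R : realType) (n : nat) (mu a b : R).
Local Notation m := (lebesgue_heis R n).

Lemma measurable_Sab_integrand (f : heis R n -> R) :
  measurable_fun setT f ->
  measurable_fun setT (fun z => Sab_integrand mu a b f z.1 z.2).
Proof.
move=> mf; apply/measurable_EFinP; apply: measurable_funM.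
  exact: measurableT_comp.
apply: (measurableT_comp (@measurable_Omega _ _ _ _)).
by apply: measurable_heis_mul_inv; measurable_proj.
Qed.

(** [f] has arbitrary sign and no integrability is assumed, so Tonelli is applied to the positive
    and negative parts separately. *)
Lemma measurable_Sab (f : heis R n -> R) :
  measurable_fun setT f -> measurable_fun setT (Sab mu a b f).
Proof.
move=> /measurable_Sab_integrand mf.
rewrite /Sab; under eq_fun do rewrite integralE.
pose F z := Sab_integrand mu a b f z.1 z.2.
have mp : measurable_fun setT F^\+ by exact: measurable_funepos.
have mn : measurable_fun setT F^\- by exact: measurable_funeneg.
apply: emeasurable_funB.
- rewrite (_ : (fun x => _) = fun x => \int[m]_y F^\+ (x, y)).
    exact: measurable_integral_section (funepos_ge0 F).
  by apply/funext => x; apply: eq_integral => y _; rewrite !funeposE.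
- rewrite (_ : (fun x => _) = fun x => \int[m]_y F^\- (x, y)).
    exact: measurable_integral_section (funeneg_ge0 F).
  by apply/funext => x; apply: eq_integral => y _; rewrite !funenegE.
Qed.

Lemma Lnorm_fin_integral (p : R) (f : heis R n -> R) : (0 < p)%R ->
  f \in Lfun m p%:E ->
  measurable_fun setT f /\
  exists N : R, [/\ (0 <= N)%R, 'N[m]_p%:E [EFin \o f] = N%:E &
    \int[m]_x (`|f x| `^ p)%:E = (N `^ p)%:E].
Proof.
move=> p0; rewrite inE => -/andP[].
rewrite inE /= => mf; rewrite inE /= /finite_norm => fN; split => //.
have N0 := Lnorm_ge0 m p%:E (EFin \o f).
exists (fine ('N[m]_p%:E [EFin \o f])); split.
- exact: fine_ge0.
- by rewrite fineK// ge0_fin_numE.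
- by rewrite -poweR_EFin fineK ?ge0_fin_numE// poweR_Lnorm ?gt_eqF.
Qed.

Lemma Sab_bounded (p q : R) :
  (1 <= n)%N -> (0 < a)%R -> (0 < b)%R -> (b < 1)%R -> (n%:R * b <= a)%R ->
  (1 < p)%R -> (p < q)%R -> ((a + b) / (n%:R + 1) = p^-1 - q^-1)%R ->
  exists C : R, (0 < C)%R /\
     forall f : heis R n -> R,
       f \in Lfun m p%:E ->
       {ae m, forall x, m.-integrable setT (Sab_integrand mu a b f x)} /\
       'N[m]_q%:E [Sab mu a b f] <= C%:E * 'N[m]_p%:E [EFin \o f].
Proof.
move=> n1 a0 b0 b1 nb p1 pq pqE.
have p0 : (0 < p)%R by rewrite (lt_trans _ p1).
have q0 : (0 < q)%R by rewrite (lt_trans p0).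
have q1 : (1 < q)%R by rewrite (lt_trans p1).
have np1 : (0 < n%:R + 1 :> R)%R by rewrite ltr_wpDl.
pose g := ((a + b) / (n%:R + 1))%R.
have g0 : (0 < g)%R by rewrite divr_gt0// addr_gt0.
have pV : (0 < p^-1 < 1)%R by rewrite invr_gt0 p0 invf_lt1.
have qV : (0 < q^-1 < 1)%R by rewrite invr_gt0 q0 invf_lt1.
(* For these exponents [al + be - 1 = 1/p - 1/q = g], and the condition [1 < al + be] reads
   [0 < g]. *)
have [C [C0 B]] : exists C : R, (0 < C)%R /\
  bilinear_bound p^-1 (1 - q^-1) m m
    (fun z => (Omega a b (heis_mul mu z.1 (heis_inv z.2)))%:E) C.
  move: pV qV => /andP[pV0 pV1] /andP[qV0 qV1].
  apply: (@heis_bilinear R n mu a b p^-1 (1 - q^-1) g) => //.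
  - by rewrite subr_gt0.
  - by rewrite ltrBlDr ltrDl.
  - by rewrite addrCA ltrDl -pqE.
  - by rewrite /g divfK// gt_eqF.
  - by rewrite /g pqE; ring.
exists C; split => // f /(Lnorm_fin_integral p0)[mf [N [N0 fN ifN]]].
have mS := measurable_Sab_integrand mf.
(* Bounding the integral of the absolute value gives absolute convergence almost everywhere and the
   norm estimate at once. *)
pose G x := \int[m]_y `|Sab_integrand mu a b f x y|.
have mSa : measurable_fun setT (fun z => `|Sab_integrand mu a b f z.1 z.2|).
  exact: measurableT_comp.
have mG : measurable_fun setT G.
  by apply: (measurable_integral_section m mSa) => z; exact: abse_ge0.
have G0 x : 0 <= G x by apply: integral_ge0 => y _; exact: abse_ge0.
have mF : measurable_fun setT (fun y => (`|f y| `^ p)%:E).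
  apply/measurable_EFinP; apply: (measurableT_comp (measurable_powR p)).
  exact: measurableT_comp.
have F0 y : 0 <= (`|f y| `^ p)%:E by rewrite lee_fin powR_ge0.
have dual (H : heis R n -> \bar R) : measurable_fun setT H -> (forall x, 0 <= H x) ->
    \int[m]_x (H x `^ (1 - q^-1) * G x) <= (C * N)%:E * (\int[m]_x H x) `^ (1 - q^-1).
  (* The second function is [|f|^p]: its power [1/p] is [|f|], and the power [1/p] of its integral
     is the norm [N]. *)
  move=> mH H0; have := B H _ mH mF H0 F0.
  rewrite ifN poweR_EFin -powRrM divff ?gt_eqF// powRr1// => BH.
  rewrite EFinM muleAC -muleA; apply: le_trans BH.
  rewrite le_eqVlt; apply/orP; left; apply/eqP; apply: eq_integral => x _.
  rewrite /G -ge0_integralZl//.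
  - apply: eq_integral => y _.
    rewrite -muleA; congr (_ * _); rewrite /Sab_integrand poweR_EFin -powRrM divff ?gt_eqF//.
    by rewrite powRr1// abse_EFin normrM (ger0_norm (Omega_ge0 _ _ _)) EFinM.
  - exact: (measurable_section1 _ mSa).
  - exact: poweR_ge0.
have CN0 : (0 <= C * N)%R by rewrite mulr_ge0// ltW.
have GA := @dual_integral_le _ _ _ m q G _ q1 mG G0 CN0 dual.
have mGq : measurable_fun setT (fun x => G x `^ q).
  exact: (measurableT_comp (measurable_poweR _)).
split.
  have : m.-integrable setT (fun x => G x `^ q).
    apply/integrableP; split => //.
    under eq_integral do rewrite gee0_abs ?poweR_ge0//.
    by apply: le_lt_trans GA _; rewrite poweR_EFin ltry.
  move=> /(integrable_ae measurableT); apply: filterS => x /(_ I) Gx.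
  apply/integrableP; split; first exact: (measurable_section1 _ mS).
  rewrite -/(G x); apply: (@lty_poweRy _ _ q); first by rewrite gt_eqF.
  by rewrite -ge0_fin_numE ?poweR_ge0.
rewrite fN -EFinM unlock /Lnorm.
apply: (@le_trans _ _ ((\int[m]_x G x `^ q) `^ q^-1)).
  have mSab := measurable_Sab mf.
  have i0 : 0 <= \int[m]_x `|Sab mu a b f x| `^ q by apply: integral_ge0 => x _; exact: poweR_ge0.
  have le : \int[m]_x `|Sab mu a b f x| `^ q <= \int[m]_x G x `^ q.
    apply: ge0_le_integral => //.
    - by move=> x _; exact: poweR_ge0.
    - by apply: (measurableT_comp (measurable_poweR _)); exact: measurableT_comp.
    - move=> x _; apply: gt0_ler_poweR; first exact: ltW.
      + by rewrite in_itv /= abse_ge0 leey.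
      + by rewrite in_itv /= G0 leey.
      + by apply: le_abse_integral => //; exact: (measurable_section1 _ mS).
  apply: gt0_ler_poweR => //; first by rewrite invr_ge0 ltW.
  - by rewrite in_itv /= i0 leey.
  - by rewrite in_itv /= (le_trans i0 le) leey.
have iG0 : 0 <= \int[m]_x G x `^ q by apply: integral_ge0 => x _; exact: poweR_ge0.
rewrite -[leRHS](_ : ((C * N)%:E `^ q) `^ q^-1 = _); last first.
  by rewrite -poweRrM divff ?gt_eqF// poweRe1.
apply: gt0_ler_poweR => //; first by rewrite invr_ge0 ltW.
- by rewrite in_itv /= iG0 leey.
- by rewrite in_itv /= lee_fin powR_ge0 leey.
Qed.

End sufficiency.

(** * Scaling *)

Section boxes.
Context (R : realType).
Local Notation RM := (measurableTypeR R).
Local Notation leb := (@lebesgue_measure R).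

Definition tuple_box n (A : set RM) : set (n.-tuple RM) :=
  [set x | forall i, A (tnth x i)].

Lemma measurable_tuple_box n (A : set RM) :
  measurable A -> measurable (@tuple_box n A).
Proof.
move=> mA.
rewrite (_ : tuple_box A = \bigcap_(i : 'I_n) ((fun x : n.-tuple RM => tnth x i) @^-1` A)).
  apply: fin_bigcap_measurable => [|i _]; first exact: finite_finset.
  by rewrite -[X in measurable X]setTI; exact: measurable_tnth.
by apply/seteqP; split => x /= xA i; [move=> _|]; exact: xA.
Qed.

Lemma prod_measureE d1 d2 (X : measurableType d1) (Y : measurableType d2)
    (m1 : {sigma_finite_measure set X -> \bar R})
    (m2 : {sigma_finite_measure set Y -> \bar R}) A B :
  measurable A -> measurable B ->
  prod_measure m1 m2 (A `*` B) = (m1 A * m2 B)%E.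
Proof. by move=> mA mB; rewrite /prod_measure product_measure1E. Qed.

Lemma lebesgue_tuple_box n (A : set RM) (r : R) : measurable A -> leb A = r%:E ->
  lebesgue_tuple R n (tuple_box A) = (r ^+ n)%:E.
Proof.
move=> mA Ar; elim: n => [|n IH].
  by rewrite /= diracE mem_set// => -[].
rewrite /= /cons_measure /pushforward.
rewrite (_ : tuple_cons (n:=n) @^-1` _ = A `*` tuple_box A).
  rewrite prod_measureE//; last exact: measurable_tuple_box.
  by rewrite exprS EFinM; congr (_ * _)%E.
apply/seteqP; split => -[x t] /=.
  move=> h; split; first by have := h ord0; rewrite tnth0.
  by move=> i; have := h (lift ord0 i); rewrite tnthS.
move=> -[Ax tA] i; case: (unliftP ord0 i) => [j ->|->]; first by rewrite tnthS.
by rewrite tnth0.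
Qed.

Definition heis_box n (A B : set RM) : set (heis R n) :=
  (tuple_box A `*` tuple_box A) `*` B.

Lemma measurable_heis_box n A B : measurable A -> measurable B ->
  measurable (@heis_box n A B).
Proof.
by move=> mA mB; apply: measurableX => //; apply: measurableX;
  exact: measurable_tuple_box.
Qed.

Lemma lebesgue_heis_box n A B (r t : R) : measurable A -> measurable B ->
  leb A = r%:E -> leb B = t%:E ->
  lebesgue_heis R n (heis_box A B) = (r ^+ n * r ^+ n * t)%:E.
Proof.
move=> mA mB Ar Bt; have mbA := @measurable_tuple_box n _ mA.
transitivity (prod_measure (lebesgue_tuple R n) (lebesgue_tuple R n)
    (tuple_box A `*` tuple_box A) * leb B)%E.
  by apply: prod_measureE => //; exact: measurableX.
by rewrite prod_measureE// (lebesgue_tuple_box _ mA Ar) EFinM; congr (_ * _)%E.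
Qed.

Lemma lebesgue_itvcc (x y : R) : x <= y -> leb `[x, y]%classic = (y - x)%:E.
Proof.
move=> xy; rewrite lebesgue_measure_itv /=; case: ifPn => [//|].
by rewrite lte_fin -leNgt => yx; rewrite (_ : y = x) ?subrr//; apply/eqP; rewrite eq_le xy yx.
Qed.

(** Both bases are at most [W] and enter with nonpositive exponents; positivity of the smaller one
    keeps the convention [0^-1 = 0] out. *)
Lemma Omega_ge n (a b W : R) (z : heis R n) : a <= n%:R -> b <= 1 ->
  0 < tdot z.1.1 z.1.1 + tdot z.1.2 z.1.2 ->
  tdot z.1.1 z.1.1 + tdot z.1.2 z.1.2 + `|z.2 : R| <= W ->
  W `^ (- (n%:R - a + (1 - b))) <= Omega a b z.
Proof.
case: z => [[xi eta] tau] /= an b1 r0 rW.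
set r := tdot xi xi + tdot eta eta in r0 rW *.
have W0 : 0 < W by rewrite (lt_le_trans r0)// (le_trans _ rW)// lerDl.
have rW' : r <= W by rewrite (le_trans _ rW)// lerDl.
have rt0 : 0 < r + `|tau : R| by rewrite ltr_wpDr.
rewrite opprD powRD; last by rewrite (gt_eqF W0) implybT.
have h c x : 0 <= c -> 0 < x -> x <= W -> W `^ (- c) <= x^-1 `^ c.
  move=> c0 x0 xW; rewrite -mulN1r powRrM powR_inv1 ?(ltW W0)//.
  by apply: ge0_ler_powR; rewrite ?nnegrE ?invr_ge0 ?(ltW W0) ?(ltW x0)// lef_pV2.
by apply: ler_pM; rewrite ?powR_ge0// h ?subr_ge0.
Qed.

End boxes.

(** * Necessity of the exponent relation *)

Section necessity.
Context (R : realType) (n : nat) (mu a b : R).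
Local Notation m := (lebesgue_heis R n).
Hypotheses (n1 : (1 <= n)%N) (an : a < n%:R) (b1 : b < 1).

(* E s is disjoint from Q s, which keeps [heis_mul mu x (heis_inv y)] away from the junk
   value 0 of Omega at xi = eta = 0. *)
Let Q (s : R) : set (heis R n) := heis_box `[0, s]%classic `[0, s ^+ 2]%classic.
Let E (s : R) : set (heis R n) :=
  heis_box `[2 * s, 3 * s]%classic `[0, s ^+ 2]%classic.
(** In units of [s^2]: [9 n] for each of the two squared norms, coordinate differences being at most
    [3 s]; 1 for the difference of last coordinates; [3 n] for each of the two dot products in the
    twist. *)
Let M : R := 18 * n%:R + 1 + `|mu| * (6 * n%:R).

Let Omega_box (s : R) x y : 0 < s -> E s x -> Q s y ->
  (M * s ^+ 2) `^ (- (n%:R - a + (1 - b))) <= Omega a b (heis_mul mu x (heis_inv y)).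
Proof.
move=> s0; case: x => [[u v] t]; case: y => [[xi eta] tau].
rewrite /E /Q /heis_box /tuple_box /= !in_itv /= => -[[uE vE] /andP[t0 ts]].
move=> -[[xE eE] /andP[h0 hs]].
have nsum c : n%:R * c = \sum_(i < n) c :> R.
  by rewrite sumr_const card_ord mulr_natl.
have cmp x y : (2 * s <= x <= 3 * s) -> (0 <= y <= s) ->
    s ^+ 2 <= (x + - y) * (x + - y) <= 9 * s ^+ 2.
  by move=> /andP[? ?] /andP[? ?]; apply/andP; split; nra.
have bnd x y : (2 * s <= x <= 3 * s) -> (0 <= y <= s) -> `|x * - y| <= 3 * s ^+ 2.
  move=> /andP[? ?] /andP[? ?]; rewrite ler_norml; apply/andP; split; nra.
have {}uE i : 2 * s <= (tnth u i : R) <= 3 * s by have := uE i; rewrite in_itv.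
have {}vE i : 2 * s <= (tnth v i : R) <= 3 * s by have := vE i; rewrite in_itv.
have {}xE i : 0 <= (tnth xi i : R) <= s by have := xE i; rewrite in_itv.
have {}eE i : 0 <= (tnth eta i : R) <= s by have := eE i; rewrite in_itv.
have td (x y : n.-tuple (measurableTypeR R)) : (forall i, 2 * s <= (tnth x i : R) <= 3 * s) ->
    (forall i, 0 <= (tnth y i : R) <= s) ->
    n%:R * s ^+ 2 <= tdot (tadd x (topp y)) (tadd x (topp y)) <= n%:R * (9 * s ^+ 2).
  move=> hx hy; rewrite /tdot !nsum.
  by apply/andP; split; apply: ler_sum => i _; rewrite !tnth_mktuple;
    have /andP[] := cmp _ _ (hx i) (hy i).
have tb (x y : n.-tuple (measurableTypeR R)) : (forall i, 2 * s <= (tnth x i : R) <= 3 * s) ->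
    (forall i, 0 <= (tnth y i : R) <= s) ->
    `|tdot x (topp y)| <= n%:R * (3 * s ^+ 2).
  move=> hx hy; rewrite /tdot (le_trans (ler_norm_sum _ _ _))//.
  rewrite nsum.
  by apply: ler_sum => i _; rewrite tnth_mktuple; exact: bnd.
apply: (@Omega_ge R n a b (M * s ^+ 2) (tadd u (topp xi), tadd v (topp eta),
  (t + - tau + mu * (tdot u (topp eta) - tdot v (topp xi)) : R)));
  rewrite ?(ltW an) ?(ltW b1)//=.
  have /andP[h1 _] := td _ _ uE xE; have /andP[h2 _] := td _ _ vE eE.
  apply: lt_le_trans (lerD h1 h2).
  by rewrite addr_gt0// mulr_gt0 ?exprn_gt0// ltr0n.
have /andP[_ h1] := td _ _ uE xE; have /andP[_ h2] := td _ _ vE eE.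
have h3 := tb _ _ uE eE; have h4 := tb _ _ vE xE.
have h5 : `|t + - tau| <= s ^+ 2 by rewrite ler_norml; lra.
have h7 : `|tdot u (topp eta) - tdot v (topp xi)| <= n%:R * (6 * s ^+ 2).
  by rewrite (le_trans (ler_normB _ _))//; lra.
have h8 := ler_wpM2l (normr_ge0 mu) h7.
rewrite -normrM in h8.
have h9 := ler_normD (t + - tau) (mu * (tdot u (topp eta) - tdot v (topp xi))).
rewrite /M; lra.
Qed.

(** The exponent [2 n + 2] is the homogeneous dimension for the dilations by [(s, s, s^2)]. *)
Let vol (s : R) : R := s ^+ n * s ^+ n * s ^+ 2.

Let mitv (x y : R) : measurable (`[x, y]%classic : set (measurableTypeR R)).
Proof. exact: measurable_itv. Qed.

Let volQ s : 0 < s -> m (Q s) = (vol s)%:E.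
Proof.
move=> s0; apply: lebesgue_heis_box => //.
- by rewrite lebesgue_itvcc ?subr0// ltW.
- by rewrite lebesgue_itvcc ?subr0// exprn_ge0// ltW.
Qed.

Let volE s : 0 < s -> m (E s) = (vol s)%:E.
Proof.
move=> s0; apply: lebesgue_heis_box => //.
- by rewrite lebesgue_itvcc; [congr EFin; ring|rewrite ler_pM2r// ler_nat].
- by rewrite lebesgue_itvcc ?subr0// exprn_ge0// ltW.
Qed.

Let mQ s : measurable (Q s). Proof. exact: measurable_heis_box. Qed.
Let mE s : measurable (E s). Proof. exact: measurable_heis_box. Qed.

Let vol_gt0 s : 0 < s -> 0 < vol s.
Proof. by move=> s0; rewrite !mulr_gt0// exprn_gt0. Qed.

Lemma Lnorm_indic (A : set (heis R n)) (p : R) : measurable A -> 0 < p ->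
  ('N[m]_p%:E [EFin \o \1_A] = m A `^ p^-1)%E.
Proof.
move=> mA p0; rewrite unlock /Lnorm; congr (_ `^ _)%E.
have <- : (\int[m]_x (\1_A x)%:E = m A)%E by rewrite integral_indic// setIT.
apply: eq_integral => x _ /=.
by rewrite indicE; case: (x \in A); rewrite /= ?normr1 ?powR1// normr0 powR0// gt_eqF.
Qed.

(** By [Omega_box], the image of the indicator of [Q s] is at least a constant times [vol s] on
    [E s]; its q-norm over [E s] brings the further factor [vol s ^ (1/q)]. *)
Lemma box_test (p q C s : R) : 1 < p -> 1 < q -> 0 < s ->
  (forall f : heis R n -> R, f \in Lfun m p%:E ->
       ('N[m]_q%:E [Sab mu a b f] <= C%:E * 'N[m]_p%:E [EFin \o f])%E) ->
  (M * s ^+ 2) `^ (- (n%:R - a + (1 - b))) * vol s * vol s `^ q^-1 <=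
  C * vol s `^ p^-1.
Proof.
move=> p1 q1 s0 B.
have p0 : 0 < p by exact: lt_trans p1.
have q0 : 0 < q by exact: lt_trans q1.
have mf : measurable_fun setT (\1_(Q s) : heis R n -> R) by exact: measurable_indic.
have fL : (\1_(Q s) : heis R n -> R) \in Lfun m p%:E.
  rewrite inE; apply/andP; split; rewrite inE//=.
  by rewrite /finite_norm Lnorm_indic// volQ// poweR_EFin ltry.
have := B _ fL; rewrite Lnorm_indic// volQ// poweR_EFin -EFinM => h.
rewrite -lee_fin; apply: le_trans h.
set k := (M * s ^+ 2) `^ (- (n%:R - a + (1 - b))).
have k0 : 0 <= k by exact: powR_ge0.
have kv0 : 0 <= k * vol s by rewrite mulr_ge0// ltW// vol_gt0.
have mS := measurable_Sab_integrand mu a b mf.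
have SE x : E s x -> ((k * vol s)%:E <= Sab mu a b (\1_(Q s)) x)%E.
  move=> Ex; rewrite EFinM -volQ// -[m (Q s)](_ : (\int[m]_y (\1_(Q s) y)%:E)%E = _); last first.
    by rewrite integral_indic// setIT.
  rewrite -ge0_integralZl_EFin//; last by apply/measurable_EFinP.
  apply: ge0_le_integral => //.
  - by move=> y _; rewrite -EFinM lee_fin mulr_ge0.
  - by apply: measurable_funeM; exact/measurable_EFinP.
  - exact: (measurable_section1 _ mS).
  - move=> y _; rewrite /Sab_integrand -EFinM lee_fin mulrC indicE.
    case: (boolP (y \in Q s)) => [|_]; last by rewrite !mul0r.
    by rewrite inE => Qy; rewrite !mul1r; exact: Omega_box.
rewrite unlock /Lnorm.
rewrite -[leLHS](_ : ((((k * vol s) `^ q) * vol s)%:E `^ q^-1)%E = _); last first.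
  rewrite poweR_EFin powRM ?powR_ge0 ?(ltW (vol_gt0 s0))//.
  by rewrite -powRrM divff ?gt_eqF// powRr1.
have le : ((((k * vol s) `^ q) * vol s)%:E <= \int[m]_x (`|Sab mu a b (\1_(Q s)) x| `^ q))%E.
  rewrite EFinM -volE// -[m (E s)](_ : (\int[m]_y (\1_(E s) y)%:E)%E = _); last first.
    by rewrite integral_indic// setIT.
  rewrite -ge0_integralZl_EFin ?powR_ge0//; last first.
    by apply/measurable_EFinP; exact: measurable_indic.
  apply: ge0_le_integral => //.
  - by move=> x _; rewrite -EFinM lee_fin mulr_ge0// powR_ge0.
  - by apply: measurable_funeM; apply/measurable_EFinP; exact: measurable_indic.
  - apply: (measurableT_comp (measurable_poweR _)); apply: measurableT_comp => //.
    exact: measurable_Sab.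
  - move=> x _; rewrite indicE; case: (boolP (x \in E s)) => [|_]; last first.
      by rewrite mule0 poweR_ge0.
    rewrite inE => Ex; rewrite mule1 -poweR_EFin.
    have Sx := SE _ Ex.
    apply: gt0_ler_poweR; rewrite ?(ltW q0)// ?in_itv /= ?abse_ge0 ?leey ?lee_fin ?kv0//.
    by rewrite (le_trans Sx)// lee_abs.
apply: gt0_ler_poweR => //; first by rewrite invr_ge0 ltW.
- by rewrite in_itv /= leey lee_fin mulr_ge0 ?powR_ge0// ltW// vol_gt0.
- by rewrite in_itv /= leey andbT integral_ge0// => x _; exact: poweR_ge0.
Qed.

(** If [e] were nonzero, some [L] would make the right side equal to [c / 2]; [L] runs over both
    signs, so the sign of [e] is immaterial. *)
Lemma scale_exponent_eq0 (c C e : R) : 0 < c -> 0 < C ->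
  (forall L, c <= C * expR (e * L)) -> e = 0.
Proof.
move=> c0 C0 h; apply/eqP/negPn/negP => e0.
have := h (ln (c / (2 * C)) / e).
rewrite mulrCA divff// mulr1 lnK ?posrE ?divr_gt0// ?mulr_gt0//.
rewrite (_ : C * (c / (2 * C)) = c / 2); last by field; rewrite gt_eqF.
by lra.
Qed.

Lemma bounded_exponent (p q C : R) : 1 < p -> 1 < q -> 0 < C ->
  (forall f : heis R n -> R, f \in Lfun m p%:E ->
       ('N[m]_q%:E [Sab mu a b f] <= C%:E * 'N[m]_p%:E [EFin \o f])%E) ->
  (a + b) / (n%:R + 1) = p^-1 - q^-1.
Proof.
move=> p1 q1 C0 B.
have M0 : 0 < M.
  by rewrite /M ltr_wpDr ?mulr_ge0// ltr_wpDl// mulr_ge0.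
pose kap := n%:R - a + (1 - b).
(* At [s = expR L] the volume is [expR (N * L)], and vanishing of the exponent reads
   [N (1/p - 1/q) = N - 2 kap = 2 (a + b)]. *)
pose N : R := 2 * n%:R + 2.
have := @scale_exponent_eq0 (M `^ (- kap)) C
  (N * p^-1 - (- (2 * kap) + N + N * q^-1)) (powR_gt0 _ M0) C0.
have n0 : 0 < n%:R + 1 :> R by rewrite ltr_wpDl.
have step L : M `^ (- kap) <= C * expR ((N * p^-1 - (- (2 * kap) + N + N * q^-1)) * L).
  have s0 := expR_gt0 L.
  have := box_test p1 q1 s0 B.
  have -> : vol (expR L) = expR (N * L).
    by rewrite /vol -!expRM_natl -!expRD; congr expR; rewrite /N; ring.
  rewrite -/kap powRM ?(ltW M0) ?exprn_ge0 ?expR_ge0// -expRM_natl -!expRM.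
  rewrite -!mulrA -!expRD => h.
  rewrite -(ler_pM2r (expR_gt0 ((- (2 * kap) + N + N * q^-1) * L))).
  rewrite -mulrA -expRD.
  move: h; congr (_ * expR _ <= _ * expR _); ring.
move=> /(_ step); rewrite /N /kap => e0.
apply: (mulIf (lt0r_neq0 n0)); rewrite divfK ?lt0r_neq0//.
lra.
Qed.

End necessity.

Theorem mainTheorem1 (R : realType) (n : nat) (mu a b p q : R) :
  (1 <= n)%N ->
  0 < a -> a < n%:R ->
  0 < b -> b < 1 ->
  n%:R * b <= a ->
  1 < p -> p < q ->
  (exists C : R, 0 < C /\
     forall f : heis R n -> R,
       f \in Lfun (lebesgue_heis R n) p%:E ->
       {ae lebesgue_heis R n, forall x,
          (lebesgue_heis R n).-integrable setT (Sab_integrand mu a b f x)} /\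
       ('N[lebesgue_heis R n]_q%:E [Sab mu a b f] <=
          C%:E * 'N[lebesgue_heis R n]_p%:E [EFin \o f])%E)
  <->
  (a + b) / (n%:R + 1) = p^-1 - q^-1.
Proof.
move=> n1 a0 an b0 b1 nb p1 pq; split.
  move=> [C [C0 B]]; apply: (bounded_exponent n1 an b1 p1 (lt_trans p1 pq) C0) => //.
  by move=> f /B[_ fq]; exact: fq.
exact: Sab_bounded.
Qed.
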